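(* Suppose that $qk_1\ge r(K_1+k_1-K_2)$. For fixed $r,q$ and strike prices $K_1,k_1,k_2,K_2$, and for every $\tau\in(0,T]$, the lower free boundary $A(\tau)$ is nonincreasing and the upper free boundary $B(\tau)$ is nondecreasing as functions of the volatility $\sigma\in(0,\infty)$, where $A$ and $B$ are the free boundaries $$A(\tau)=\max\{x\le\ln K_1:Y(x,\tau)=K_2-k_1\},\qquad B(\tau)=\min\{x\in[\ln K_1,\ln k_1]:Y(x,\tau)=e^x-K_1+K_2-k_1\}$$ of the bounded strong solution $Y$ of the call-side obstacle problem with volatility $\sigma$.
   Context: Constants: $0<K_1<k_1<k_2<K_2$, $\sigma>0$, $r>0$, $q\ge0$, $T>0$. Put $\mathcal Lu:=\frac{\sigma^2}{2}\partial_{xx}u+\left(r-q-\frac{\sigma^2}{2}\right)\partial_xu-ru$ (depending on $\sigma$) and $\psi_1(x):=(e^x-K_1)^++K_2-k_1$. Let $Q=(-\infty,\ln k_1)\times(0,T]$. For $1<p<\infty$, $\mathcal W_p(Q)$ is the set of $u\in C((-\infty,\ln k_1]\times[0,T])$ such that, for all $R,\rho>0$, $u,\partial_xu,\partial_{xx}u,\partial_\tau u$ (weak derivatives) belong to $L^p$ of $\left(((-\infty,\ln k_1)\cap(-R,R))\times(0,T)\right)\setminus B_\rho(\ln K_1,0)$, where $B_\rho$ denotes an open disc of radius $\rho$. A strong solution of the call-side obstacle problem is a function $Y\in\mathcal W_p(Q)$ with $Y\ge\psi_1$ in $Q$, $\partial_\tau Y-\mathcal LY\ge0$ almost everywhere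 in $Q$, $\partial_\tau Y-\mathcal LY=0$ almost everywhere on $\{Y>\psi_1\}$, $Y(x,0)=\psi_1(x)$ for $x<\ln k_1$, and $Y(\ln k_1,\tau)=K_2-K_1$ for $\tau\in[0,T]$. For every $1<p<\infty$ there is exactly one bounded strong solution, and it does not depend on $p$. For each $\tau\in(0,T]$, $\{x\le\ln K_1:Y(x,\tau)=\psi_1(x)\}=(-\infty,A(\tau)]$ and $\{x\in[\ln K_1,\ln k_1]:Y(x,\tau)=\psi_1(x)\}=[B(\tau),\ln k_1]$ with $A(\tau)<\ln K_1<B(\tau)$. *)

(* Defs.v *)
From HB Require Import structures.
From mathcomp Require Import all_boot all_order all_algebra.
From mathcomp Require Import all_classical all_reals all_analysis.
Set Implicit Arguments.
Unset Strict Implicit.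
Unset Printing Implicit Defensive.
Import Order.TTheory GRing.Theory Num.Theory.
Import numFieldNormedType.Exports.
Local Open Scope classical_set_scope.
Local Open Scope ring_scope.

(* Points of the plane are pairs z = (x, tau): log-price and time to expiry. *)

Definition lebesgue2 (R : realType) :
    {measure set (measurableTypeR R * measurableTypeR R) -> \bar R} :=
  (@lebesgue_measure R \x @lebesgue_measure R)%E.

Definition dir_x (R : realType) : R * R := (1, 0).
Definition dir_tau (R : realType) : R * R := (0, 1).
Arguments dir_x {R}.
Arguments dir_tau {R}.

Definition iter_derive (R : realType) (s : seq (R * R)) (f : R * R -> R) :
    R * R -> R :=
  foldr (fun v (g : R * R -> R) z => 'D_v g z) f s.

(* C^infty: all iterated directional derivatives exist and are continuous. *)
Definition smooth (R : realType) (f : R * R -> R) : Prop :=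
  forall s : seq (R * R),
    continuous (iter_derive s f) /\
    forall v z, derivable (iter_derive s f) z v.

Definition test_function (R : realType) (Omega : set (R * R))
    (phi : R * R -> R) : Prop :=
  let supp := closure [set z | phi z != 0] in
  [/\ smooth phi, compact supp & supp `<=` Omega].

Definition loc_integrable (R : realType) (Omega : set (R * R))
    (f : R * R -> R) : Prop :=
  forall K : set (R * R), compact K -> K `<=` Omega ->
    (lebesgue2 R).-integrable K (EFin \o f).

(* v is the weak derivative of u on the open set Omega, of order size s, along
   the directions listed in s. *)
Definition weak_derivative (R : realType) (Omega : set (R * R))
    (s : seq (R * R)) (u v : R * R -> R) : Prop :=
  [/\ loc_integrable Omega u, loc_integrable Omega v &
    forall phi : R * R -> R, test_function Omega phi ->
      \int[lebesgue2 R]_(z in Omega) (u z * iter_derive s phi z) =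
      (-1) ^+ size s * \int[lebesgue2 R]_(z in Omega) (v z * phi z)].

Definition domain (R : realType) (k1 T : R) : set (R * R) :=
  [set z | z.1 < ln k1 /\ 0 < z.2 <= T].

Definition open_domain (R : realType) (k1 T : R) : set (R * R) :=
  [set z | z.1 < ln k1 /\ 0 < z.2 < T].

Definition closed_domain (R : realType) (k1 T : R) : set (R * R) :=
  [set z | z.1 <= ln k1 /\ 0 <= z.2 <= T].

(* The disc is written out because the library's [ball] on R * R is a square. *)
Definition local_domain (R : realType) (K1 k1 T rad rho : R) : set (R * R) :=
  [set z | [/\ z.1 < ln k1, - rad < z.1 < rad & 0 < z.2 < T]] `\`
  [set z | (z.1 - ln K1) ^+ 2 + z.2 ^+ 2 < rho ^+ 2].

Definition Lp_on (R : realType) (p : R) (D : set (R * R)) (f : R * R -> R) :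
    Prop :=
  f \_ D \in Lfun (lebesgue2 R) p%:E.

Definition parabolic_derivatives (R : realType) (k1 T : R)
    (u ux uxx ut : R * R -> R) : Prop :=
  let Omega := open_domain k1 T in
  [/\ weak_derivative Omega [:: dir_x] u ux,
      weak_derivative Omega [:: dir_x; dir_x] u uxx &
      weak_derivative Omega [:: dir_tau] u ut].

Definition in_Wp (R : realType) (K1 k1 T p : R) (u : R * R -> R) : Prop :=
  {within closed_domain k1 T, continuous u} /\
  exists ux uxx ut : R * R -> R,
    parabolic_derivatives k1 T u ux uxx ut /\
    forall rad rho : R, 0 < rad -> 0 < rho ->
      let D := local_domain K1 k1 T rad rho in
      [/\ Lp_on p D u, Lp_on p D ux, Lp_on p D uxx & Lp_on p D ut].

(* The value of the operator on a function with value u, first and second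
   x-derivatives ux and uxx. *)
Definition opL (R : realType) (r q sigma u ux uxx : R) : R :=
  sigma ^+ 2 / 2 * uxx + (r - q - sigma ^+ 2 / 2) * ux - r * u.

Definition psi1 (R : realType) (K1 k1 K2 x : R) : R :=
  Num.max (expR x - K1) 0 + K2 - k1.

Definition strong_solution (R : realType) (K1 k1 K2 r q T sigma p : R)
    (Y : R * R -> R) : Prop :=
  let Q := domain k1 T in
  [/\ in_Wp K1 k1 T p Y,
      forall z, Q z -> psi1 K1 k1 K2 z.1 <= Y z,
      exists Yx Yxx Yt : R * R -> R,
        [/\ parabolic_derivatives k1 T Y Yx Yxx Yt,
            {ae lebesgue2 R, forall z, Q z ->
              0 <= Yt z - opL r q sigma (Y z) (Yx z) (Yxx z)} &
            {ae lebesgue2 R, forall z, Q z -> psi1 K1 k1 K2 z.1 < Y z ->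
              Yt z - opL r q sigma (Y z) (Yx z) (Yxx z) = 0}],
      forall x, x < ln k1 -> Y (x, 0) = psi1 K1 k1 K2 x &
      forall tau, 0 <= tau <= T -> Y (ln k1, tau) = K2 - K1].

Definition bounded_strong_solution (R : realType)
    (K1 k1 K2 r q T sigma p : R) (Y : R * R -> R) : Prop :=
  strong_solution K1 k1 K2 r q T sigma p Y /\
  [bounded Y z | z in closed_domain k1 T].

Definition is_max (R : realType) (S : set R) (a : R) : Prop :=
  S a /\ ubound S a.

Definition is_min (R : realType) (S : set R) (a : R) : Prop :=
  S a /\ lbound S a.

Definition lower_contact (R : realType) (K1 k1 K2 : R) (Y : R * R -> R)
    (tau : R) : set R :=
  [set x | x <= ln K1 /\ Y (x, tau) = K2 - k1].

Definition upper_contact (R : realType) (K1 k1 K2 : R) (Y : R * R -> R)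
    (tau : R) : set R :=
  [set x | ln K1 <= x <= ln k1 /\ Y (x, tau) = expR x - K1 + K2 - k1].

(* Main.v *)
Require Import Defs.
From HB Require Import structures.
From mathcomp Require Import all_boot all_order all_algebra.
From mathcomp Require Import all_classical all_reals all_analysis.
From mathcomp Require Import measurable_realfun lebesgue_integral_under ring lra.
Set Implicit Arguments.
Unset Strict Implicit.
Unset Printing Implicit Defensive.
Import Order.TTheory GRing.Theory Num.Theory.
Import numFieldNormedType.Exports.
Local Open Scope classical_set_scope.
Local Open Scope ring_scope.

(** Differentiating the equation would need regularity across the free boundary, where only weak
    derivatives are available. A translate needs none: with constant coefficients, [exp(r h)] times
    a translate of a supersolution is again a supersolution. The direction [(- (r - q), 1)] is the
    one for which the derivative of the translate at [h = 0] is [Y_t - (r - q) Y_x + r Y]; dividing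
    by [h] removes an error [O(h^2)]. Write [m = K1 + k1 - K2]. On the upper branch [exp x - m] of
    the obstacle, [u_xx - u_x] vanishes up to no remainder, so the residual [q exp x - r m] does not
    depend on the volatility, and the hypothesis on [q k1] says that it is nonnegative at
    [x = ln k1]. If [r < q] the translate moves towards [x = ln k1], and the comparison takes place
    on a smaller half-line. Mollification yields uniform approximation only, without control on the
    derivatives of the approximants. The maximum principle is therefore stated for uniform limits of
    classical subsolutions. Weak derivatives are tested on [0 < tau < T], so the comparison of
    solutions is made before [T] and extended to [T] by continuity. *)

(* The free boundaries are read off the contact set of Y, so it suffices that Y
   is nondecreasing in sigma.  A strong solution is a distributional
   supersolution, and a distributional solution on the open set {Y > psi1}; as
   the operator has constant coefficients, mollification turns this into
   classical (in)equalities, to which the maximum principle applies whatever the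
   exponent p is.

   Since the operator is
     u_t - (r - q) u_x + r u - sigma^2 / 2 (u_xx - u_x),
   the solution Y for sigma is a subsolution for a larger volatility on {Y > psi1}
   as soon as Y_xx - Y_x >= 0 there, that is, as soon as
   Y_t - (r - q) Y_x + r Y >= 0.  This first-order inequality is itself a
   comparison, between Y and its translate
     exp(r h) Y(x - (r - q) h, tau + h),
   up to an error O(h^2).  The translate dominates Y on the contact set because
   psi1 must be a supersolution there, at the initial time because Y dominates a
   European price, and at x = ln k1 because of the hypothesis on q k1. *)

(** * Smooth compactly supported kernels *)

Section flat_function.
Context {R : realType}.
Implicit Types (n : nat) (t : R).

(* The family [flat n] spans a space stable under differentiation, which is what
   makes [flat 0] smooth at [0]. *)
Definition flat n t : R := if 0 < t then t^-1 ^+ n * expR (- t^-1) else 0.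

Lemma flat_ge0 n t : 0 <= flat n t.
Proof.
rewrite /flat; case: ifPn => // t0.
by rewrite mulr_ge0 ?expR_ge0 ?exprn_ge0 ?invr_ge0 ?ltW.
Qed.

Lemma flat_le_fact n t : flat n t <= n`!%:R.
Proof.
rewrite /flat; case: ifPn => // t0.
rewrite expRN ler_pdivrMr ?expR_gt0//.
have y0 : 0 <= t^-1 by rewrite invr_ge0 ltW.
case: n => [|n]; first by rewrite expr0 fact0 mul1r; apply: le_trans (expR_ge1Dx _); lra.
rewrite -ler_pdivrMl ?ltr0n ?fact_gt0// mulrC.
by apply: le_trans (expR_ge1Dxn n y0); lra.
Qed.

Lemma flat_le n t : flat n t <= `|t| * flat n.+1 t.
Proof.
rewrite /flat; case: ifPn => t0; last by rewrite mulr0.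
by rewrite gtr0_norm// exprS !mulrA mulfV ?mul1r// gt_eqF.
Qed.

Lemma is_derive_flat n t :
  is_derive t 1 (flat n) (flat n.+2 t - n%:R * flat n.+1 t).
Proof.
have [t0|t0|->] := ltgtP t 0.
- rewrite /flat !ltNge (ltW t0)/= mulr0 subr0.
  apply: (@near_eq_is_derive _ _ _ (cst 0)) => //.
  near=> s; rewrite /= ltNge.
  suff -> : s <= 0 by [].
  by apply: ltW; near: s; exact: lt_nbhsl.
- rewrite /flat t0.
  apply: (@near_eq_is_derive _ _ _ (fun s : R => s^-1 ^+ n * expR (- s^-1))).
  + near=> s.
    suff -> : 0 < s by [].
    by near: s; exact: lt_nbhsr.
  have tN0 : t != 0 by rewrite gt_eqF.
  have dV : is_derive t 1 (fun s : R => s^-1) (- (t^-1 ^+ 2)).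
    apply: is_derive_eq; first exact: is_deriveV.
    by rewrite exprVn; exact: mulr1.
  have dX : is_derive t 1 (fun s : R => s^-1 ^+ n)
      (- (n%:R * t^-1 ^+ n.+1)).
    rewrite (_ : (fun s : R => s^-1 ^+ n) = (fun s : R => s^-1) ^+ n); last first.
      by rewrite exprfctE.
    apply: is_derive_eq.
    rewrite /GRing.scale/= -mulr_natl; case: n => [|n]/=.
      by rewrite !mul0r oppr0.
    by rewrite !exprS; ring.
  have dE : is_derive t 1 (fun s : R => expR (- s^-1)) (t^-1 ^+ 2 * expR (- t^-1)).
    have := @is_derive1_comp _ expR _ _ _ _ (is_derive_expR _) (is_deriveN dV).
    by move=> H; apply: is_derive_eq H _; rewrite opprK mulrC.
  have := is_deriveM dX dE => H; apply: is_derive_eq H _.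
  rewrite /GRing.scale/= !exprS; ring.
- rewrite /flat ltxx mulr0 subr0.
  suff H : h^-1 *: (flat n (h *: 1 + 0) - flat n 0) @[h --> 0^'] --> (0 : R).
    by apply: DeriveDef; [apply: cvgP H|apply: cvg_lim H].
  apply/cvgrPdist_le => e e0.
  near=> h.
  have hN0 : h != 0 by near: h; exact: nbhs_dnbhs_neq.
  rewrite addr0 {2}/flat ltxx subr0 sub0r normrN /GRing.scale/= mulr1.
  rewrite normrM (ger0_norm (flat_ge0 _ _)) normfV.
  rewrite -ler_pdivlMl ?invr_gt0 ?normr_gt0// invrK.
  (* Using [flat_le] twice makes [flat n h] of order [h ^+ 2], so the difference quotient at [0] is
     of order [h]. *)
  apply: le_trans (flat_le _ _) _; rewrite ler_wpM2l//.
  apply: le_trans (flat_le _ _) _.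
  apply: (@le_trans _ _ (`|h| * n.+2`!%:R)).
    by rewrite ler_wpM2l// flat_le_fact.
  rewrite -ler_pdivlMr ?ltr0n ?fact_gt0//.
  near: h; apply: dnbhs0_le.
  by rewrite divr_gt0 ?ltr0n ?fact_gt0.
Unshelve. all: by end_near. Qed.

Lemma flat_gt0 n t : (0 < flat n t) = (0 < t).
Proof.
rewrite /flat; case: ifPn => [t0|]; last by rewrite ltxx.
by rewrite mulr_gt0 ?exprn_gt0 ?invr_gt0 ?expR_gt0.
Qed.

Lemma continuous_flat n : continuous (flat n).
Proof.
move=> t; apply: differentiable_continuous; apply/derivable1_diffP.
by have [] := is_derive_flat n t.
Qed.

End flat_function.

(** * A class of smooth kernels closed under differentiation *)

Section flat_expressions.
Context {R : realType}.
Implicit Types (f g : R * R -> R) (z v : R * R).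

Lemma differentiable_fst z : differentiable (fst : R * R -> R) z.
Proof.
by apply: linear_differentiable => y; exact: (@cvg_fst _ _ (nbhs y.1) (nbhs y.2)).
Qed.

Lemma differentiable_snd z : differentiable (snd : R * R -> R) z.
Proof.
by apply: linear_differentiable => y; exact: (@cvg_snd _ _ (nbhs y.1) (nbhs y.2)).
Qed.

Lemma derive_coord f z v : differentiable f z ->
  'D_v f z = v.1 * 'D_dir_x f z + v.2 * 'D_dir_tau f z.
Proof.
move=> df; rewrite !deriveE//.
have {1}-> : v = v.1 *: dir_x + v.2 *: dir_tau.
  case: v => v1 v2; congr (_, _); rewrite /= /GRing.scale/=.
    by rewrite mulr1 mulr0 addr0.
  by rewrite mulr1 mulr0 add0r.
by rewrite linearD !linearZ.
Qed.

(** This class contains the kernels and is stable under directional derivatives and under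
    [y |-> z - y]. Whatever induction proves for its members, such as boundedness or measurability,
    therefore holds for all derivatives of a kernel as well. *)
Inductive flat_expr : (R * R -> R) -> Prop :=
| flat_expr_cst c : flat_expr (cst c)
| flat_expr_flat n a b c : flat_expr (fun z => flat n (a + b * z.1 + c * z.2))
| flat_expr_add f g : flat_expr f -> flat_expr g -> flat_expr (fun z => f z + g z)
| flat_expr_mul f g : flat_expr f -> flat_expr g -> flat_expr (fun z => f z * g z).

Lemma differentiable_affine (a b c : R) z :
  differentiable (fun z : R * R => a + b * z.1 + c * z.2) z.
Proof.
apply: (@differentiableD _ _ _ (fun z : R * R => a + b * z.1) (fun z => c * z.2)).
- apply: (@differentiableD _ _ _ (cst a) (fun z : R * R => b * z.1)) => //.
  exact: (differentiableZ _ (differentiable_fst z)).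
- exact: (differentiableZ _ (differentiable_snd z)).
Qed.

Lemma differentiable_flat n (t : R) : differentiable (flat n) t.
Proof. by apply/derivable1_diffP; have [] := is_derive_flat n t. Qed.

Lemma flat_expr_differentiable f z : flat_expr f -> differentiable f z.
Proof.
elim=> {f} [c|n a b c|f g _ df _ dg|f g _ df _ dg].
- exact: differentiable_cst.
- apply: (@differentiable_comp _ _ _ _ (fun z : R * R => a + b * z.1 + c * z.2) (flat n)).
    exact: differentiable_affine.
  exact: differentiable_flat.
- exact: differentiableD.
- exact: differentiableM.
Qed.

Lemma derive_fst z v : 'D_v fst z = v.1.
Proof.
rewrite deriveE; last exact: differentiable_fst.
by rewrite diff_lin// => y; exact: (@cvg_fst _ _ (nbhs y.1) (nbhs y.2)).
Qed.

Lemma derive_snd z v : 'D_v snd z = v.2.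
Proof.
rewrite deriveE; last exact: differentiable_snd.
by rewrite diff_lin// => y; exact: (@cvg_snd _ _ (nbhs y.1) (nbhs y.2)).
Qed.

Lemma derive_affine (a b c : R) z v :
  'D_v (fun z : R * R => a + b * z.1 + c * z.2) z = b * v.1 + c * v.2.
Proof.
have df : is_derive z v (fst : R * R -> R) v.1.
  by apply: DeriveDef; [exact/diff_derivable/differentiable_fst|exact: derive_fst].
have ds : is_derive z v (snd : R * R -> R) v.2.
  by apply: DeriveDef; [exact/diff_derivable/differentiable_snd|exact: derive_snd].
have [_ E] := is_deriveD (is_deriveD (is_derive_cst a z v)
  (@is_deriveZ _ _ _ _ b _ _ _ df)) (@is_deriveZ _ _ _ _ c _ _ _ ds).
by apply: etrans E _; rewrite add0r.
Qed.

Lemma derive_flat_affine n (a b c : R) z v :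
  'D_v (fun z : R * R => flat n (a + b * z.1 + c * z.2)) z =
  (b * v.1 + c * v.2) * (flat n.+2 (a + b * z.1 + c * z.2)
    - n%:R * flat n.+1 (a + b * z.1 + c * z.2)).
Proof.
set l := fun z : R * R => a + b * z.1 + c * z.2.
have dl := differentiable_affine a b c z.
have df := differentiable_flat n (l z).
rewrite (_ : (fun z => _) = flat n \o l)// deriveE; last exact: differentiable_comp.
have dlE : 'd l z v = b * v.1 + c * v.2 by rewrite -deriveE// /l derive_affine.
rewrite diff_comp//= deriv1E; last by have [] := is_derive_flat n (l z).
by rewrite dlE derive1E; have [_ ->] := is_derive_flat n (l z).
Qed.

Lemma flat_expr_ext f g : f =1 g -> flat_expr f -> flat_expr g.
Proof. by move=> /funext ->. Qed.

Lemma flat_expr_derive f v : flat_expr f -> flat_expr (fun z => 'D_v f z).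
Proof.
have sub n k a b c : flat_expr (fun z => k * (flat n.+2 (a + b * z.1 + c * z.2)
    - n%:R * flat n.+1 (a + b * z.1 + c * z.2))).
  apply: flat_expr_mul; first exact: flat_expr_cst.
  apply: flat_expr_add; first exact: flat_expr_flat.
  apply: (@flat_expr_ext (fun z => - n%:R * flat n.+1 (a + b * z.1 + c * z.2))).
    by move=> z; rewrite mulNr.
  by apply: flat_expr_mul; [exact: flat_expr_cst|exact: flat_expr_flat].
elim=> {f} [c|n a b c|f g Ff Df Fg Dg|f g Ff Df Fg Dg].
- apply: flat_expr_ext _ (flat_expr_cst 0) => z.
  by rewrite derive_cst.
- by apply: flat_expr_ext _ (sub n (b * v.1 + c * v.2) a b c) => z; rewrite derive_flat_affine.
- apply: flat_expr_ext _ (flat_expr_add Df Dg) => z.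
  by rewrite -deriveD//; exact/diff_derivable/flat_expr_differentiable.
- apply: flat_expr_ext _ (flat_expr_add (flat_expr_mul Ff Dg) (flat_expr_mul Fg Df)) => z.
  by rewrite -deriveM//; exact/diff_derivable/flat_expr_differentiable.
Qed.

Lemma flat_expr_iter_derive s f : flat_expr f -> flat_expr (iter_derive s f).
Proof. by move=> Ff; elim: s => //= v s; exact: flat_expr_derive. Qed.

Lemma flat_expr_continuous f : flat_expr f -> continuous f.
Proof. by move=> Ff z; exact/differentiable_continuous/flat_expr_differentiable. Qed.

Lemma flat_expr_smooth f : flat_expr f -> smooth f.
Proof.
move=> /flat_expr_iter_derive Ff s; split; first exact: flat_expr_continuous.
by move=> v z; exact/diff_derivable/flat_expr_differentiable.
Qed.

Lemma flat_expr_bounded f : flat_expr f -> exists M, forall z, `|f z| <= M.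
Proof.
elim=> {f} [c|n a b c|f g _ [M fM] _ [N gN]|f g _ [M fM] _ [N gN]].
- by exists `|c|.
- by exists n`!%:R => z; rewrite ger0_norm ?flat_ge0 ?flat_le_fact.
- by exists (M + N) => z; rewrite (le_trans (ler_normD _ _))// lerD.
- by exists (M * N) => z; rewrite normrM ler_pM.
Qed.

Lemma measurable_affine (a b c : R) :
  measurable_fun [set: measurableTypeR R * measurableTypeR R]
    (fun z => a + b * z.1 + c * z.2 : measurableTypeR R).
Proof.
apply: measurable_funD; [apply: measurable_funD; [exact: measurable_cst|]|].
- by apply: measurable_funM; [exact: measurable_cst|exact: measurable_fst].
- by apply: measurable_funM; [exact: measurable_cst|exact: measurable_snd].
Qed.

Lemma flat_expr_measurable f : flat_expr f ->
  measurable_fun [set: measurableTypeR R * measurableTypeR R]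
    (f : _ -> measurableTypeR R).
Proof.
elim=> {f} [c|n a b c|f g _ mf _ mg|f g _ mf _ mg].
- exact: measurable_cst.
- apply: (measurableT_comp _ (measurable_affine a b c)).
  by apply: continuous_measurable_fun; exact: continuous_flat.
- exact: measurable_funD.
- exact: measurable_funM.
Qed.

Lemma flat_expr_reflect f z : flat_expr f -> flat_expr (fun y => f (z - y)).
Proof.
elim=> {f} [c|n a b c|f g _ Ff _ Fg|f g _ Ff _ Fg].
- exact: flat_expr_cst.
- apply: flat_expr_ext _ (flat_expr_flat n (a + b * z.1 + c * z.2) (- b) (- c)) => y.
  by congr flat; rewrite /=; ring.
- exact: flat_expr_add.
- exact: flat_expr_mul.
Qed.

Lemma derive_reflect f z v y : differentiable f (z - y) ->
  'D_v (fun y => f (z - y)) y = - 'D_v f (z - y).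
Proof.
move=> df.
have dg : differentiable (fun y => z - y) y.
  by apply: (@differentiableB _ _ _ (cst z) id).
have dgE : 'd (fun y => z - y) y v = - v.
  rewrite -deriveE//; transitivity ('D_v (cst z - id) y) => //.
  by rewrite deriveB// derive_cst derive_id sub0r.
transitivity ('D_v (f \o (fun y => z - y)) y) => //.
rewrite deriveE; last exact: differentiable_comp.
by rewrite diff_comp//= dgE linearN deriveE.
Qed.

(** The four one-sided factors make the function positive exactly on the open square of half side
    [e]; the pairing of signs makes it even. *)
Definition bump_fun (e : R) (y : R * R) : R :=
  flat 0 (e + y.1) * flat 0 (e - y.1) * (flat 0 (e + y.2) * flat 0 (e - y.2)).

Lemma flat_expr_bump_fun e : flat_expr (bump_fun e).
Proof.
have F b c : flat_expr (fun y => flat 0 (e + b * y.1 + c * y.2)).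
  exact: flat_expr_flat.
apply: flat_expr_ext _ (flat_expr_mul (flat_expr_mul (F 1 0) (F (-1) 0))
  (flat_expr_mul (F 0 1) (F 0 (-1)))) => y /=.
by rewrite /bump_fun !mul1r !mul0r !addr0 !mulN1r.
Qed.

Lemma bump_fun_ge0 e y : 0 <= bump_fun e y.
Proof. by rewrite /bump_fun !mulr_ge0// flat_ge0. Qed.

Lemma bump_fun_neq0 e y : (bump_fun e y != 0) = (`|y.1| < e) && (`|y.2| < e).
Proof.
have F (t : R) : (flat 0 (e + t) != 0) && (flat 0 (e - t) != 0) = (`|t| < e).
  have E s : (flat 0 s != 0) = (0 < s :> R) by rewrite -(flat_gt0 0) lt0r flat_ge0 andbT.
  by rewrite !E ltr_norml -ltrBlDl sub0r subr_gt0.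
by rewrite /bump_fun !mulf_eq0 !negb_or !F.
Qed.

End flat_expressions.

(** * Mollification *)

Section translation.
Context {R : realType}.
Local Notation mR := (measurableTypeR R).

Let measurable_shift (c : R) :
  measurable_fun [set: mR] (fun x : mR => c + x : mR).
Proof. by apply: measurable_funD; [exact: measurable_cst|exact: measurable_id]. Qed.

Lemma lebesgue_measure_shift (c : R) (A : set mR) : measurable A ->
  lebesgue_measure ((fun x : mR => c + x : mR) @^-1` A) = lebesgue_measure A.
Proof.
move=> mA; pose f : mR -> mR := fun x => c + x.
pose f' := isMeasurableFun.Build _ _ _ _ f (measurable_shift c).
pose F : {mfun mR >-> mR} := HB.pack f f'.
apply/esym; apply: (@lebesgue_measure_unique R (pushforward lebesgue_measure F)) mA.
move=> _ [[a b] _ <-]/=.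
rewrite /pushforward (_ : F @^-1` _ = `](a - c), (b - c)]%classic); last first.
  by apply/seteqP; split => x /=; rewrite !in_itv/= ltrBlDl lerBrDl.
rewrite !lebesgue_measure_itv/= !lte_fin ltrD2r; case: ifPn => // ab.
by rewrite -!EFinB; congr EFin; ring.
Qed.

Lemma measurable_shift2 (c : R * R) :
  measurable_fun [set: mR * mR] (fun z : mR * mR => c + z : mR * mR).
Proof.
apply/measurable_fun_pair => /=.
- exact: (measurableT_comp (measurable_shift c.1) measurable_fst).
- exact: (measurableT_comp (measurable_shift c.2) measurable_snd).
Qed.

Lemma lebesgue2_shift (c : R * R) (A : set (mR * mR)) : measurable A ->
  lebesgue2 R ((fun z : mR * mR => c + z : mR * mR) @^-1` A) = lebesgue2 R A.
Proof.
move=> mA; pose f : mR * mR -> mR * mR := fun z => c + z.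
pose f' := isMeasurableFun.Build _ _ _ _ f (measurable_shift2 c).
pose F : {mfun (mR * mR)%type >-> (mR * mR)%type} := HB.pack f f'.
apply/esym; apply: (@product_measure_unique _ _ _ _ _ lebesgue_measure lebesgue_measure
  (pushforward (lebesgue2 R) F)) mA.
move=> X Y mX mY.
change (lebesgue2 R (((fun x : mR => c.1 + x : mR) @^-1` X) `*`
   ((fun x : mR => c.2 + x : mR) @^-1` Y)) = (lebesgue_measure X * lebesgue_measure Y)%E).
have mp (k : R) (C : set mR) : measurable C ->
    measurable ((fun x : mR => k + x : mR) @^-1` C).
  by move=> mC; rewrite -[X in measurable X]setTI; exact: measurable_shift.
rewrite [LHS]product_measure1E; [|exact: mp|exact: mp].
by congr (_ * _)%E; exact: lebesgue_measure_shift.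
Qed.

Lemma ge0_integral_shift2 (c : R * R) (f : mR * mR -> \bar R) :
  measurable_fun setT f -> (forall z, 0 <= f z)%E ->
  (\int[lebesgue2 R]_z f (c + z)%R = \int[lebesgue2 R]_z f z)%E.
Proof.
move=> mf f0.
have := @ge0_integral_pushforward _ _ _ _ R _ (measurable_shift2 c) (lebesgue2 R) setT
  f measurableT.
rewrite preimage_setT => <-.
- apply: eq_measure_integral; first exact: measurable_shift2.
  by move=> mF A mA _; exact: lebesgue2_shift.
- exact: mf.
- by move=> z _; exact: f0.
Qed.

Lemma integral_shift2 (c : R * R) (f : mR * mR -> \bar R) :
  measurable_fun setT f ->
  (\int[lebesgue2 R]_z f (c + z)%R = \int[lebesgue2 R]_z f z)%E.
Proof.
move=> mf; rewrite integralE [RHS]integralE; congr (_ - _)%E.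
- rewrite -(ge0_integral_shift2 c (measurable_funepos mf) (funepos_ge0 f)).
  by apply: eq_integral => z _; rewrite !funeposE.
- rewrite -(ge0_integral_shift2 c (measurable_funeneg mf) (funeneg_ge0 f)).
  by apply: eq_integral => z _; rewrite !funenegE.
Qed.

Lemma integrable_shift2 (c : R * R) (f : mR * mR -> \bar R) :
  (lebesgue2 R).-integrable setT f ->
  (lebesgue2 R).-integrable setT (fun z => f (c + z)).
Proof.
move=> /integrableP[mf f_lty]; apply/integrableP; split.
  exact: (measurableT_comp mf (measurable_shift2 c)).
have ma : measurable_fun setT (fun z => `|f z|)%E by exact: measurableT_comp.
have -> := ge0_integral_shift2 c ma (fun z => abse_ge0 (f z)).
exact: f_lty.
Qed.

End translation.

Section plane_boxes.
Context {R : realType}.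
Implicit Types (z w : R * R) (d : R).

Definition box z d : set (R * R) :=
  [set w | `|w.1 - z.1| < d /\ `|w.2 - z.2| < d].

Lemma nbhs_boxP z (P : set (R * R)) :
  nbhs z P <-> exists2 d, 0 < d & box z d `<=` P.
Proof.
split=> [/nbhs_ballP[d /= d0 dP]|[d d0 dP]].
  exists d => // w [w1 w2]; apply: dP; split; rewrite /ball/= distrC//.
apply/nbhs_ballP; exists d => // w [w1 w2]; apply: dP.
by split; rewrite distrC.
Qed.

Lemma continuous_boxP (f : R * R -> R) z :
  {for z, continuous f} <->
  forall e, 0 < e -> exists2 d, 0 < d & forall w, box z d w -> `|f w - f z| <= e.
Proof.
split=> [cf e e0|cf].
  have /cvgrPdist_le/(_ e e0)/nbhs_boxP[d d0 dP] := cf.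
  by exists d => // w /dP; rewrite /= distrC.
apply/cvgrPdist_le => e e0; apply/nbhs_boxP.
by have [d d0 dP] := cf e e0; exists d => // w /dP; rewrite /= distrC.
Qed.

End plane_boxes.

(** * Convolution over a fixed set, and its derivatives *)

Section weighted_convolution.
Context {R : realType}.
Local Notation mR := (measurableTypeR R).
Implicit Types (u g : R * R -> R) (z v y : R * R) (K : set (mR * mR)).

Lemma flat_expr_measurable_reflect g z (D : set (mR * mR)) : flat_expr g ->
  measurable_fun D (fun y : mR * mR => g (z - y) : mR).
Proof.
move=> Fg; apply: measurable_funTS.
exact: (flat_expr_measurable (flat_expr_reflect z Fg)).
Qed.

Lemma integrable_mul_flat_expr K u g z : measurable K ->
  (lebesgue2 R).-integrable K (EFin \o u) -> flat_expr g ->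
  (lebesgue2 R).-integrable K (EFin \o (fun y => u y * g (z - y))).
Proof.
move=> mK iu Fg.
have [M gM] := flat_expr_bounded Fg.
apply: (@integrableMl _ _ _ _ K mK _ (fun y => g (z - y)) iu).
  exact: flat_expr_measurable_reflect.
exists M; split; first exact: num_real.
by move=> x Mx y _; apply: le_trans (gM _) (ltW Mx).
Qed.

Lemma is_derive_line (F : R * R -> R) z v (t d : R) :
  is_derive (z + t *: v) v F d -> is_derive t 1 (fun t => F (z + t *: v)) d.
Proof.
move=> [dF dE].
have E : (fun h : R => h^-1 *: (((fun t => F (z + t *: v)) \o shift t) (h *: 1)
      - F (z + t *: v))) =
    (fun h => h^-1 *: ((F \o shift (z + t *: v)) (h *: v) - F (z + t *: v))).
  apply/funext => h; congr (_ *: (_ - _)) => /=; congr F.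
  by congr (_, _); rewrite /= /GRing.scale/=; ring.
by apply: DeriveDef; rewrite /derivable /derive E.
Qed.

(** The integral runs over a fixed [K] because strong solutions and their weak derivatives are only
    locally integrable. It is the usual convolution as soon as [K] contains the support of
    [y |-> g (z - y)]. *)
Definition convol K u g z : R := \int[lebesgue2 R]_(y in K) (u y * g (z - y)).

Lemma is_derive_convol K u g z v : measurable K ->
  (lebesgue2 R).-integrable K (EFin \o u) -> flat_expr g ->
  is_derive z v (convol K u g) (convol K u (fun y => 'D_v g y) z).
Proof.
move=> mK iu Fg.
have Dg := flat_expr_derive v Fg.
have [M gM] := flat_expr_bounded Dg.
have M0 : 0 <= M by apply: le_trans (gM 0).
pose f (t : R) (y : mR * mR) := u y * g (z + t *: v - y).
have dgt (t : R) (y : R * R) : is_derive t 1 (fun t => g (z + t *: v - y))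
    ('D_v g (z + t *: v - y)).
  under eq_fun do rewrite addrAC; rewrite addrAC.
  apply: is_derive_line; apply: derivableP.
  exact/diff_derivable/flat_expr_differentiable.
have df (t : R) (y : mR * mR) : is_derive t 1 (f ^~ y) (u y * 'D_v g (z + t *: v - y)).
  by have H := @is_deriveZ _ _ _ _ (u y) _ _ _ (dgt t y); exact: H.
(* Any interval around [0] would do: the dominating function [M * |u|] is uniform in [t]. *)
have I0 : `](-1), 1[%classic (0 : R) by rewrite /= in_itv/=; apply/andP; split; lra.
have intf (t : R) : `](-1), 1[%classic t -> (lebesgue2 R).-integrable K (EFin \o f t).
  by move=> _; exact: integrable_mul_flat_expr.
have derf (t : R) y : `](-1), 1[%classic t -> K y -> derivable (f ^~ y) t 1.
  by move=> _ _; have [] := df t y.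
have G0 y : 0 <= M * `|u y| by rewrite mulr_ge0.
have iG : (lebesgue2 R).-integrable K (EFin \o (fun y => M * `|u y|)).
  exact: (integrableZl mK M (integrable_norm iu)).
have Gub (t : R) y : `](-1), 1[%classic t -> K y -> `|partial1of2 f t y| <= M * `|u y|.
  move=> _ _; rewrite partial1of2E; have [_ ->] := df t y.
  by rewrite normrM mulrC ler_wpM2r.
have H := cvg_differentiation_under_integral mK I0 intf derf G0 iG Gub.
suff cvgU : h^-1 *: ((convol K u g \o shift z) (h *: v) - convol K u g z)
    @[h --> 0^'] --> convol K u (fun y => 'D_v g y) z.
  by apply: DeriveDef; [apply: cvgP cvgU|apply: cvg_lim cvgU].
rewrite [X in _ --> X](_ : _ = \int[lebesgue2 R]_(y in K) (partial1of2 f 0 y)); last first.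
  apply: eq_Rintegral => y _; rewrite partial1of2E; have [_ ->] := df 0 y.
  by rewrite scale0r addr0.
apply: cvg_trans H; apply: near_eq_cvg; near=> h.
by rewrite /= /convol /f scale0r !addr0 [_ + z]addrC.
Unshelve. all: by end_near. Qed.

Lemma convol_derive_coord K u g z v : measurable K ->
  (lebesgue2 R).-integrable K (EFin \o u) -> flat_expr g ->
  convol K u (fun y => 'D_v g y) z =
  v.1 * convol K u (fun y => 'D_dir_x g y) z +
  v.2 * convol K u (fun y => 'D_dir_tau g y) z.
Proof.
move=> mK iu Fg.
have iD w := integrable_mul_flat_expr z mK iu (flat_expr_derive w Fg).
rewrite /convol -!RintegralZl//.
rewrite -RintegralD//; [|exact: (integrableZl mK _ (iD dir_x))
  |exact: (integrableZl mK _ (iD dir_tau))].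
apply: eq_Rintegral => y _; rewrite derive_coord; last exact: flat_expr_differentiable.
by ring.
Qed.

Lemma convol_bounded K u g : measurable K ->
  (lebesgue2 R).-integrable K (EFin \o u) -> flat_expr g ->
  exists M, forall z, `|convol K u g z| <= M.
Proof.
move=> mK iu Fg; have [M gM] := flat_expr_bounded Fg.
exists (\int[lebesgue2 R]_(y in K) (`|u y| * M)) => z.
have iug := integrable_mul_flat_expr z mK iu Fg.
apply: le_trans (le_normr_Rintegral mK iug) _.
apply: le_Rintegral => //.
- exact: integrable_norm.
- exact: (integrableZr mK M (integrable_norm iu)).
- by move=> y _; rewrite normrM ler_wpM2l.
Qed.

Lemma continuous_convol K u g : measurable K ->
  (lebesgue2 R).-integrable K (EFin \o u) -> flat_expr g ->
  continuous (convol K u g).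
Proof.
move=> mK iu Fg z.
have [M1 M1P] := convol_bounded mK iu (flat_expr_derive dir_x Fg).
have [M2 M2P] := convol_bounded mK iu (flat_expr_derive dir_tau Fg).
have M10 : 0 <= M1 by apply: le_trans (M1P 0).
have M20 : 0 <= M2 by apply: le_trans (M2P 0).
(* A Lipschitz bound: mean value theorem along the segment from [z] to [w], the two partial
   derivatives being bounded convolutions. *)
have lip w : `|convol K u g w - convol K u g z| <=
    M1 * `|w.1 - z.1| + M2 * `|w.2 - z.2|.
  set v := w - z.
  have dU (t : R) := is_derive_line (is_derive_convol (z + t *: v) v mK iu Fg).
  have cU : {within `[0 : R, 1], continuous (fun t => convol K u g (z + t *: v))}.
    apply: derivable_within_continuous => t _.
    by have [] := dU t.
  have [c _] := MVT_segment ler01 (fun t _ => dU t) cU.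
  rewrite scale1r scale0r addr0 subr0 mulr1 (_ : z + v = w) => [->|]; last first.
    by rewrite /v addrC subrK.
  rewrite convol_derive_coord//.
  move: (M1P (z + c *: v)) (M2P (z + c *: v)).
  rewrite (_ : w.1 - z.1 = v.1)// (_ : w.2 - z.2 = v.2)//.
  move: (convol _ _ _ _) (convol _ _ _ _) v.1 v.2 => A B v1 v2 AM BM.
  apply: le_trans (ler_normD _ _) _; rewrite !normrM.
  by apply: lerD; rewrite mulrC ler_wpM2r.
apply/continuous_boxP => e e0.
have M0 : 0 < M1 + M2 + 1 by lra.
exists (e / (M1 + M2 + 1)); first by rewrite divr_gt0.
move=> w [/ltW w1 /ltW w2]; apply: le_trans (lip w) _.
have := ler_wpM2l M10 w1; have := ler_wpM2l M20 w2.
have : e = (M1 + M2 + 1) * (e / (M1 + M2 + 1)) by rewrite mulrC divfK// gt_eqF.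
have : 0 < e / (M1 + M2 + 1) by rewrite divr_gt0.
by move: (e / _) => q; nra.
Qed.

End weighted_convolution.

(** * The kernel on squares and its total mass *)

Section mollifier.
Context {R : realType}.
Local Notation mR := (measurableTypeR R).
Implicit Types (u g : R * R -> R) (z v y : R * R) (K : set (mR * mR)) (e d : R).

Definition cbox z d : set (R * R) :=
  [set w | `|w.1 - z.1| <= d /\ `|w.2 - z.2| <= d].

Lemma cboxE z d :
  cbox z d = `[z.1 - d, z.1 + d]%classic `*` `[z.2 - d, z.2 + d]%classic.
Proof.
by apply/seteqP; split => w /=; rewrite /cbox/= !in_itv/= !ler_distl.
Qed.

Lemma compact_cbox z d : compact (cbox z d).
Proof. by rewrite cboxE; apply: compact_setX; exact: segment_compact. Qed.

Lemma measurable_cbox z d : measurable (cbox z d : set (mR * mR)).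
Proof. by rewrite cboxE; apply: measurableX; exact: measurable_itv. Qed.

Lemma box_sub_cbox z d : box z d `<=` cbox z d.
Proof. by move=> w [/ltW ? /ltW ?]. Qed.

(** Evenness turns the reflection [z - y] into the translation [- z + y], so that translation
    invariance of the measure computes the mass of the kernel at every [z]. *)
Lemma bump_fun_reflect e z y : bump_fun e (z - y) = bump_fun e (- z + y).
Proof.
have E1 : e - (z.1 - y.1) = e + (- z.1 + y.1) by rewrite opprB [_ - z.1]addrC.
have E2 : e - (z.2 - y.2) = e + (- z.2 + y.2) by rewrite opprB [_ - z.2]addrC.
have F1 : e + (z.1 - y.1) = e - (- z.1 + y.1) by rewrite opprD opprK.
have F2 : e + (z.2 - y.2) = e - (- z.2 + y.2) by rewrite opprD opprK.
by rewrite /bump_fun /= E1 E2 F1 F2; congr (_ * _); rewrite mulrC.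
Qed.

Lemma bump_fun_eq0 e z y : ~ box z e y -> bump_fun e (z - y) = 0.
Proof.
move=> zey; apply/eqP; apply/negPn/negP; rewrite bump_fun_neq0 => /andP[h1 h2].
by apply: zey; split; rewrite distrC.
Qed.

Definition mass e : R := \int[lebesgue2 R]_y bump_fun e y.

Lemma integral_bump_fun K e z : measurable K -> box z e `<=` K ->
  \int[lebesgue2 R]_(y in K) bump_fun e (z - y) = mass e.
Proof.
move=> mK zK; rewrite Rintegral_mkcond /mass /Rintegral; congr fine.
have mb := flat_expr_measurable (flat_expr_bump_fun e).
rewrite -(integral_shift2 (- z) (measurableT_comp (@EFin_measurable R setT) mb)).
apply: eq_integral => y _; congr EFin; rewrite -bump_fun_reflect patchE.
by case: ifPn => // /negP; rewrite inE => Ky; rewrite bump_fun_eq0// => /zK.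
Qed.

Lemma lebesgue2_cbox z d : 0 < d ->
  lebesgue2 R (cbox z d) = ((2 * d) * (2 * d))%:E.
Proof.
move=> d0; rewrite cboxE.
have E (c : R) : lebesgue_measure (`[c - d, c + d]%classic : set mR) = (2 * d)%:E.
  rewrite lebesgue_measure_itv/= lte_fin ifT; last by lra.
  by rewrite -EFinB; congr EFin; ring.
rewrite [LHS]product_measure1E; [|exact: measurable_itv|exact: measurable_itv].
rewrite EFinM; congr (_ * _)%E; exact: E.
Qed.

Lemma integrable_cst_cbox z d c : 0 < d ->
  (lebesgue2 R).-integrable (cbox z d) (EFin \o cst c).
Proof.
move=> d0; apply: measurable_bounded_integrable.
- exact: measurable_cbox.
- by rewrite lebesgue2_cbox// ltry.
- exact: measurable_cst.
- by exists `|c|; split; [exact: num_real|move=> M cM y _; exact: ltW].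
Qed.

Lemma le_flat0 (s t : R) : 0 < s -> s <= t -> flat 0 s <= flat 0 t.
Proof.
move=> s0 st; have t0 := lt_le_trans s0 st.
by rewrite /flat s0 t0 !expr0 !mul1r ler_expR lerN2 lef_pV2.
Qed.

Lemma mass_gt0 e : 0 < e -> 0 < mass e.
Proof.
move=> e0; have e20 : 0 < e / 2 by lra.
(* On the square of half side [e / 2] each of the four factors of the kernel is at least
   [flat 0 (e / 2)], by monotonicity. *)
pose c := (flat 0 (e / 2)) ^+ 4.
have c0 : 0 < c by rewrite exprn_gt0// flat_gt0.
rewrite -(@integral_bump_fun (cbox 0 e) e 0); last 2 first.
- exact: measurable_cbox.
- exact: box_sub_cbox.
have ib : (lebesgue2 R).-integrable (cbox 0 e) (EFin \o (fun y => bump_fun e (0 - y))).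
  have := integrable_mul_flat_expr 0 (measurable_cbox 0 e)
    (integrable_cst_cbox 0 1 e0) (flat_expr_bump_fun e).
  by rewrite /cst; under eq_fun do rewrite mul1r.
have ic : (lebesgue2 R).-integrable (cbox 0 (e / 2)) (EFin \o cst c).
  exact: integrable_cst_cbox.
have sub : cbox 0 (e / 2) `<=` cbox 0 e.
  by move=> w [w1 w2]; split; [apply: le_trans w1 _|apply: le_trans w2 _]; lra.
have ib2 := integrableS (measurable_cbox 0 e) (measurable_cbox 0 (e / 2)) sub ib.
apply: (@lt_le_trans _ _ (\int[lebesgue2 R]_(y in cbox 0 (e / 2)) c)).
  rewrite Rintegral_cst; last exact: measurable_cbox.
  have e21 : 0 < 2 * (e / 2) by lra.
  by rewrite lebesgue2_cbox//=; apply: mulr_gt0 => //; apply: mulr_gt0.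
apply: (@le_trans _ _ (\int[lebesgue2 R]_(y in cbox 0 (e / 2)) bump_fun e (0 - y))).
  apply: le_Rintegral => //; first exact: measurable_cbox.
  move=> y [y1 y2]; rewrite /c /bump_fun (_ : 4 = 2 + 2)%N// exprD !expr2.
  have f0 : 0 <= flat 0 (e / 2) by exact: flat_ge0.
  move: y1 y2; rewrite !subr0 !ler_norml => /andP[y11 y12] /andP[y21 y22].
  by rewrite /= ler_pM ?mulr_ge0// ler_pM// le_flat0//= ; lra.
apply: fine_le.
- exact: (integrable_fin_num (measurable_cbox 0 (e / 2)) ib2).
- exact: (integrable_fin_num (measurable_cbox 0 e) ib).
- apply: ge0_subset_integral => //.
  + exact: measurable_cbox.
  + exact: measurable_cbox.
  + exact: (measurable_int _ ib).
  + by move=> y _; rewrite lee_fin bump_fun_ge0.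
Qed.

End mollifier.

(** * Weak derivatives under convolution *)

Section weak_derivative_convolution.
Context {R : realType}.
Local Notation mR := (measurableTypeR R).
Implicit Types (u w g : R * R -> R) (z v y : R * R) (e d : R).

Lemma iter_derive_reflect s g z : flat_expr g ->
  iter_derive s (fun y => g (z - y)) =
  (fun y => (-1) ^+ size s * iter_derive s g (z - y)).
Proof.
move=> Fg; elim: s => [|v s IHs] /=.
  by apply/funext => y; rewrite mul1r.
apply/funext => y; rewrite IHs.
have Fs := flat_expr_iter_derive s Fg.
have ds : derivable (fun y => iter_derive s g (z - y)) y v.
  exact/diff_derivable/flat_expr_differentiable/(flat_expr_reflect z Fs).
rewrite (_ : (fun y => _) = (-1) ^+ size s \*: (fun y => iter_derive s g (z - y)))//.
rewrite deriveZ// derive_reflect; last exact: flat_expr_differentiable.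
by rewrite exprS /GRing.scale/=; ring.
Qed.

Lemma iter_derive_eq0 s g (K : set (R * R)) : closed K ->
  (forall y, ~ K y -> g y = 0) -> forall y, ~ K y -> iter_derive s g y = 0.
Proof.
move=> cK g0; elim: s => //= v s IHs y Ky.
rewrite (@near_eq_derive _ _ _ _ (cst 0)); first by rewrite derive_cst.
have : nbhs y (~` K) by apply: open_nbhs_nbhs; split => //; exact: closed_openC.
by apply: filterS => w; exact: IHs.
Qed.

Lemma test_function_reflect (Omega K : set (R * R)) g z : flat_expr g ->
  compact K -> K `<=` Omega -> (forall y, ~ K y -> g (z - y) = 0) ->
  test_function Omega (fun y => g (z - y)).
Proof.
move=> Fg cK KO g0.
have clK : closed K by apply: compact_closed => //; exact: norm_hausdorff.
have sub : closure [set y | g (z - y) != 0] `<=` K.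
  rewrite closureE; apply: smallest_sub => // y /= gy.
  by apply: contrapT => /g0 /eqP; rewrite (negPf gy).
split.
- exact: flat_expr_smooth (flat_expr_reflect z Fg).
- by apply: subclosed_compact sub => //; exact: closed_closure.
- exact: subset_trans sub KO.
Qed.

Lemma Rintegral_support (D K : set (mR * mR)) (f : mR * mR -> R) :
  K `<=` D -> (forall y, ~ K y -> f y = 0) ->
  \int[lebesgue2 R]_(y in D) f y = \int[lebesgue2 R]_(y in K) f y.
Proof.
move=> KD f0; rewrite Rintegral_mkcond [RHS]Rintegral_mkcond; congr Rintegral.
apply/funext => y; rewrite !patchE; case: ifPn => yD; case: ifPn => yK //.
- by rewrite f0// => /mem_set; exact/negP.
- by move: yK yD; rewrite !inE notin_setE => /KD.
Qed.

(** The test function is [y |-> g (z - y)]. Each derivative of it produces a sign by the chain rule,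
    and these signs cancel the one in the definition of the weak derivative. *)
Lemma weak_convol (Omega K : set (R * R)) s u w g z :
  weak_derivative Omega s u w -> flat_expr g -> compact K ->
  measurable (K : set (mR * mR)) -> K `<=` Omega ->
  (forall y, ~ K y -> g (z - y) = 0) ->
  convol K u (iter_derive s g) z = convol K w g z.
Proof.
move=> [iu _ uw] Fg cK mK KO g0.
have clK : closed K by apply: compact_closed => //; exact: norm_hausdorff.
have := uw _ (test_function_reflect Fg cK KO g0).
rewrite iter_derive_reflect//.
have Fs := flat_expr_iter_derive s Fg.
have sg0 y : ~ K y -> iter_derive s g (z - y) = 0.
  move=> Ky; have := iter_derive_eq0 s clK g0 Ky.
  rewrite iter_derive_reflect// => /eqP; rewrite mulf_eq0 signr_eq0/=.
  by move/eqP.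
rewrite (Rintegral_support KO); last by move=> y /sg0 ->; rewrite !mulr0.
rewrite (Rintegral_support KO); last by move=> y /g0 ->; rewrite mulr0.
rewrite -/(convol K w g z) => H.
have sgnK (x : R) : (-1) ^+ size s * ((-1) ^+ size s * x) = x.
  by rewrite mulrA -expr2 sqrr_sign mul1r.
rewrite -[RHS]sgnK -H -RintegralZl//.
  by apply: eq_Rintegral => y _; rewrite [RHS]mulrCA sgnK.
have := integrable_mul_flat_expr z mK (iu K cK KO) Fs.
move/(integrableZl mK ((-1) ^+ size s)); apply: eq_integrable => // y _ /=.
by rewrite -EFinM mulrCA.
Qed.

End weak_derivative_convolution.

Section jets.
Context {R : realType}.
Implicit Types (F : R * R -> R) (z : R * R).

(** Exactly the information used at a maximum point: continuity and classical derivatives along the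
    two coordinate slices, pointwise at [z]. *)
Definition jet (F Fx Fxx Ft : R * R -> R) z : Prop :=
  [/\ {for z, continuous F},
      is_derive z.1 1 (fun s => F (s, z.2)) (Fx z),
      is_derive z.1 1 (fun s => Fx (s, z.2)) (Fxx z) &
      is_derive z.2 1 (fun t => F (z.1, t)) (Ft z)].

Lemma is_derive_slice_x F z (d : R) : is_derive z dir_x F d ->
  is_derive z.1 1 (fun s => F (s, z.2)) d.
Proof.
have E : (fun s => F (s, z.2)) = (fun s => F ((0, z.2) + s *: dir_x)).
  by apply/funext => s; congr F; congr (_, _); rewrite /= /GRing.scale/= ?mulr1 ?mulr0 ?add0r ?addr0.
move=> H; rewrite E; apply: is_derive_line.
rewrite [X in is_derive X](_ : _ = z)//.
by rewrite [RHS]surjective_pairing; congr (_, _); rewrite /= /GRing.scale/= ?mulr1 ?mulr0 ?add0r ?addr0.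
Qed.

Lemma is_derive_slice_tau F z (d : R) : is_derive z dir_tau F d ->
  is_derive z.2 1 (fun t => F (z.1, t)) d.
Proof.
have E : (fun t => F (z.1, t)) = (fun t => F ((z.1, 0) + t *: dir_tau)).
  by apply/funext => s; congr F; congr (_, _); rewrite /= /GRing.scale/= ?mulr1 ?mulr0 ?add0r ?addr0.
move=> H; rewrite E; apply: is_derive_line.
rewrite [X in is_derive X](_ : _ = z)//.
by rewrite [RHS]surjective_pairing; congr (_, _); rewrite /= /GRing.scale/= ?mulr1 ?mulr0 ?add0r ?addr0.
Qed.

Lemma jet_convol (K : set (measurableTypeR R * measurableTypeR R)) u g z :
  measurable K -> (lebesgue2 R).-integrable K (EFin \o u) -> flat_expr g ->
  jet (convol K u g) (convol K u (iter_derive [:: dir_x] g))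
    (convol K u (iter_derive [:: dir_x; dir_x] g))
    (convol K u (iter_derive [:: dir_tau] g)) z.
Proof.
move=> mK iu Fg; have Dg := flat_expr_derive dir_x Fg; split.
- exact: continuous_convol.
- exact/is_derive_slice_x/is_derive_convol.
- exact: (is_derive_slice_x (is_derive_convol z dir_x mK iu Dg)).
- exact/is_derive_slice_tau/is_derive_convol.
Qed.

End jets.

(** * Approximation and inequalities for mollified functions *)

Section mollification.
Context {R : realType}.
Local Notation mR := (measurableTypeR R).
Implicit Types (u g : R * R -> R) (z v y c : R * R) (K : set (mR * mR)) (e d : R).

(** A form of Heine's theorem in which the second point [y] may leave the compact square; the kernel
    centred at a boundary point of the square does so too. *)
Lemma uniform_continuity_cbox u z d :
  (forall w, cbox z d w -> {for w, continuous u}) ->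
  forall eps, 0 < eps -> exists2 e, 0 < e &
    forall w y, cbox z d w -> box w e y -> `|u y - u w| <= eps.
Proof.
move=> cu eps eps0.
have cov := (compact_near_coveringP (@cbox R z d)).1 (@compact_cbox R z d).
pose P e w := forall y, box w e y -> `|u y - u w| <= eps.
have H : forall x, cbox z d x ->
    \forall w \near x & e \near (0 : R)^'+, P e w.
  move=> x /cu /continuous_boxP/(_ (eps / 2)); rewrite divr_gt0//.
  move=> /(_ isT)[r r0 ur].
  exists (box x (r / 2), [set e | e < r / 2]).
    split=> /=; last by apply: nbhs_right_lt; rewrite divr_gt0.
    by apply/nbhs_boxP; exists (r / 2) => //; rewrite divr_gt0.
  move=> [w e] /= [[w1 w2] er] y [y1 y2].
  have yx : box x r y.
    split; [rewrite (_ : y.1 - x.1 = (y.1 - w.1) + (w.1 - x.1))|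
      rewrite (_ : y.2 - x.2 = (y.2 - w.2) + (w.2 - x.2))]; try by ring.
      by apply: le_lt_trans (ler_normD _ _) _; lra.
    by apply: le_lt_trans (ler_normD _ _) _; lra.
  have wx : box x r w by split; lra.
  rewrite (_ : u y - u w = (u y - u x) - (u w - u x)); last by ring.
  by apply: le_trans (ler_normB _ _) _; move: (ur _ yx) (ur _ wx); lra.
have [e [/= He e0]] := filter_ex (filterI (cov _ _ _ _ H) (nbhs_right_gt 0)).
by exists e => // w y zw; exact: He.
Qed.

Definition mollifier e y : R := (mass e)^-1 * bump_fun e y.

Lemma flat_expr_mollifier e : flat_expr (@mollifier e).
Proof. by apply: flat_expr_mul; [exact: flat_expr_cst|exact: flat_expr_bump_fun]. Qed.

Lemma mollifier_ge0 e y : 0 < e -> 0 <= mollifier e y.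
Proof. by move=> e0; rewrite mulr_ge0 ?bump_fun_ge0// invr_ge0 ltW// mass_gt0. Qed.

Lemma mollifier_eq0 e z y : ~ box z e y -> mollifier e (z - y) = 0.
Proof. by move=> zy; rewrite /mollifier bump_fun_eq0// mulr0. Qed.

Lemma convol_cst K e z b : measurable K -> box z e `<=` K -> 0 < e ->
  (lebesgue2 R).-integrable K (EFin \o cst 1) ->
  convol K (cst b) (mollifier e) z = b.
Proof.
move=> mK zK e0 i1; rewrite /convol /mollifier /=.
under eq_Rintegral do rewrite mulrA.
rewrite RintegralZl//; last first.
  have := integrable_mul_flat_expr z mK i1 (flat_expr_bump_fun e).
  by apply: eq_integrable => // y _; rewrite /= mul1r.
by rewrite integral_bump_fun// -mulrA mulVf ?mulr1// gt_eqF// mass_gt0.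
Qed.

Lemma convol_le_cst K u e z b : measurable K -> box z e `<=` K -> 0 < e ->
  (lebesgue2 R).-integrable K (EFin \o cst 1) ->
  (lebesgue2 R).-integrable K (EFin \o u) ->
  (forall y, box z e y -> u y <= b) -> convol K u (mollifier e) z <= b.
Proof.
move=> mK zK e0 i1 iu ub; rewrite -[leRHS](convol_cst b mK zK e0 i1).
have ib : (lebesgue2 R).-integrable K (EFin \o cst b).
  by have := integrableZl mK b i1; apply: eq_integrable => // y _ /=; rewrite mule1.
apply: le_Rintegral => //.
- exact: integrable_mul_flat_expr iu (flat_expr_mollifier e).
- exact: integrable_mul_flat_expr ib (flat_expr_mollifier e).
- move=> y _; have [zy|zy] := pselect (box z e y).
    by rewrite ler_wpM2r ?mollifier_ge0// ub.
  by rewrite mollifier_eq0// !mulr0.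
Qed.

Lemma convol_near K u e z b d : measurable K -> box z e `<=` K -> 0 < e ->
  (lebesgue2 R).-integrable K (EFin \o cst 1) ->
  (lebesgue2 R).-integrable K (EFin \o u) ->
  (forall y, box z e y -> `|u y - b| <= d) ->
  `|convol K u (mollifier e) z - b| <= d.
Proof.
move=> mK zK e0 i1 iu ub.
rewrite ler_distl; apply/andP; split.
  have iN : (lebesgue2 R).-integrable K (EFin \o (fun y => - u y)).
    by have := integrableZl mK (-1) iu; apply: eq_integrable => // y _ /=; rewrite -EFinM mulN1r.
  have : convol K (fun y => - u y) (mollifier e) z <= - (b - d).
    apply: convol_le_cst => // y /ub; rewrite ler_distl => /andP[]; lra.
  rewrite (_ : convol K (fun y => - u y) _ z = - convol K u (mollifier e) z); first by lra.
  rewrite /convol -mulN1r -RintegralZl//.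
    by apply: eq_Rintegral => y _; rewrite mulNr mulN1r.
  exact: integrable_mul_flat_expr iu (flat_expr_mollifier e).
by apply: convol_le_cst => // y /ub; rewrite ler_distl => /andP[].
Qed.

(** Convolution commutes with translations and the kernel is nonnegative, so an inequality between
    [u] and its translate is inherited by the mollified function. The integrands are extended by
    zero to the whole plane, where the measure is translation invariant, since [K] itself is not. *)
Lemma convol_shift K u e z c a b : measurable K ->
  box z e `<=` K -> box (c + z) e `<=` K -> 0 < e ->
  (lebesgue2 R).-integrable K (EFin \o cst 1) ->
  (lebesgue2 R).-integrable K (EFin \o u) ->
  (forall y, box z e y -> u y <= a * u (c + y) + b) ->
  convol K u (mollifier e) z <= a * convol K u (mollifier e) (c + z) + b.
Proof.
move=> mK zK czK e0 i1 iu ub.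
have Fm := flat_expr_mollifier e.
pose f := (fun y => u y * mollifier e (z - y)) \_ K.
pose h := (fun y => u y * mollifier e (c + z - y)) \_ K.
pose k := (fun y => cst b y * mollifier e (z - y)) \_ K.
have ib : (lebesgue2 R).-integrable K (EFin \o cst b).
  by have := integrableZl mK b i1; apply: eq_integrable => // y _ /=; rewrite mule1.
have tr w (q : R * R -> R) : (lebesgue2 R).-integrable K (EFin \o q) ->
    (lebesgue2 R).-integrable setT (EFin \o ((fun y => q y * mollifier e (w - y)) \_ K)).
  move=> iq; have := integrable_mul_flat_expr w mK iq Fm.
  by move/(integrable_mkcond _ mK).1; rewrite restrict_EFin.
have if_ := tr z _ iu.
have ih := tr (c + z) _ iu.
have ik := tr z _ ib.
have ihs : (lebesgue2 R).-integrable setT (EFin \o (fun y => h (c + y))).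
  exact: (integrable_shift2 c ih).
have iah : (lebesgue2 R).-integrable setT (EFin \o (fun y => a * h (c + y))).
  exact: (integrableZl measurableT a ihs).
have -> : convol K u (mollifier e) z = \int[lebesgue2 R]_y f y.
  by rewrite /convol Rintegral_mkcond.
have -> : convol K u (mollifier e) (c + z) = \int[lebesgue2 R]_y h (c + y).
  transitivity (\int[lebesgue2 R]_y h y); first by rewrite /convol Rintegral_mkcond.
  exact: (congr1 fine (esym (integral_shift2 c (measurable_int _ ih)))).
have -> : b = \int[lebesgue2 R]_y k y.
  by rewrite -[LHS](convol_cst b mK zK e0 i1) /convol Rintegral_mkcond.
rewrite -RintegralZl// -RintegralD//.
apply: le_Rintegral => //; first exact: (integrableD measurableT iah ik).
move=> y _; rewrite /f /h /k !patchE.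
have [zy|zy] := pselect (box z e y); last first.
  have E : c + z - (c + y) = z - y by rewrite opprD addrACA subrr add0r.
  by rewrite E mollifier_eq0// !mulr0; do 2 case: ifP => _; rewrite ?mulr0 ?addr0.
have czy : box (c + z) e (c + y).
  by case: zy => h1 h2; split; rewrite /= opprD addrACA subrr add0r.
have Kcy : c + y \in K by apply/mem_set/czK.
have Ky : y \in K by apply/mem_set/zK.
rewrite Kcy Ky.
rewrite (_ : c + z - (c + y) = z - y); last by rewrite opprD addrACA subrr add0r.
by rewrite mulrA -mulrDl ler_wpM2r ?mollifier_ge0// ub.
Qed.

End mollification.

(** * Maximum principle *)

Section derivative_tests.
Context {R : realType}.
Implicit Types (k dk : R -> R) (x l C d : R).

(* The sign [s] selects the side: [s = 1] compares with points to the right of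
   [x], [s = -1] with points to the left. *)
Lemma one_sided_derive_ge k x (s l C d v : R) : `|s| = 1 -> 0 < d ->
  (forall h, 0 < h < d -> l * h - C * h ^+ 2 <= s * (k (x + s * h) - k x)) ->
  is_derive x 1 k v -> l <= v.
Proof.
move=> s1 d0 lk [dk <-{v}]; rewrite leNgt; apply/negP => vl.
set v := 'D_1 k x in vl *.
have sN0 : s != 0 by rewrite -normr_gt0 s1.
have cv : h^-1 *: ((k \o shift x) (h *: 1) - k x) @[h --> 0^'] --> v by [].
pose q := l - v; have q0 : 0 < q by rewrite subr_gt0.
have /cvgrPdist_lt/(_ _ (_ : 0 < q / 2)) := cv; rewrite divr_gt0// => /(_ isT).
move=> [r /= r0 rP].
have C1 : 0 < `|C| + 1 by rewrite ltr_wpDl.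
pose m := Num.min (r / 2) (Num.min (d / 2) (q / 2 / (`|C| + 1))).
have m0 : 0 < m by rewrite !lt_min !divr_gt0.
have [mr [md mq]] : m <= r / 2 /\ m <= d / 2 /\ m <= q / 2 / (`|C| + 1).
  by rewrite /m !ge_min !lexx !orbT.
have smN : `|s * m| = m by rewrite normrM s1 mul1r gtr0_norm.
have := rP (s * m); rewrite /ball/= sub0r normrN smN.
have -> : m < r by lra.
have smN0 : s * m != 0 by rewrite mulf_neq0// gt_eqF.
move=> /(_ isT smN0).
have ss : s * s = 1 by rewrite -expr2 -real_normK ?num_real// s1 expr1n.
rewrite /GRing.scale/= mulr1 invfM.
have -> : s^-1 = s by apply: (mulfI sN0); rewrite mulfV// ss.
have := lk m; rewrite m0 (_ : m < d); last by lra.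
move=> /(_ isT); rewrite [x + _]addrC.
set w := k _ - k x => lw.
rewrite ltr_distl => /andP[Xv _]; move: Xv.
have mq' : m * (`|C| + 1) <= q / 2 by rewrite -ler_pdivlMr.
have : l - C * m <= s / m * w.
  rewrite mulrAC ler_pdivlMr//; apply: le_trans lw.
  by rewrite mulrBl expr2 mulrA.
have Cm : C * m <= m * (`|C| + 1) by have := ler_norm C; nra.
by move: (s / m * w) (C * m) (m * (`|C| + 1)) Cm mq' => X Y Z; rewrite /q; lra.
Qed.

(** A parabola that touches [k] from above at [x] has the slope of [k] there, by the two one-sided
    tests. Were [v] larger than [2 * C], [k] would rise above the parabola just to the right of
    [x]. *)
Lemma second_derive_le k dk x (l C d v : R) : 0 < d ->
  (forall h, `|h| < d -> is_derive (x + h) 1 k (dk (x + h))) ->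
  is_derive x 1 dk v ->
  (forall h, `|h| < d -> k (x + h) <= k x + l * h + C * h ^+ 2) ->
  dk x = l /\ v <= 2 * C.
Proof.
move=> d0 dkP ddk kP.
have dkx : is_derive x 1 k (dk x).
  by have := dkP 0; rewrite normr0 addr0; apply.
have dkl : dk x = l.
  apply/eqP; rewrite eq_le; apply/andP; split.
    rewrite -lerN2; apply: (@one_sided_derive_ge (fun s => - k s) x 1 _ C d) => //.
    - by rewrite normr1.
    - move=> h /andP[h0 hd]; rewrite !mul1r.
      by have := kP h; rewrite gtr0_norm// => /(_ hd); lra.
  apply: (@one_sided_derive_ge k x (-1) _ C d) => //.
  - by rewrite normrN1.
  - move=> h /andP[h0 hd]; rewrite !mulN1r.
    by have := kP (- h); rewrite normrN gtr0_norm// => /(_ hd); rewrite sqrrN; lra.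
split=> //; rewrite leNgt; apply/negP => vC.
(* [C'] is the midpoint of [C] and [v / 2]. The function [j] below has positive derivative just to
   the right of [x] because [2 * C' < v], while [C < C'] forces it to decrease. *)
pose C' := (2 * C + v) / 4; have CC' : C < C' by rewrite /C'; lra.
have C'v : 2 * C' < v by rewrite /C'; lra.
case: ddk => dd vE.
have cv : h^-1 *: ((dk \o shift x) (h *: 1) - dk x) @[h --> 0^'] --> v.
  by rewrite -vE.
have /cvgrPdist_lt/(_ (v - 2 * C')) := cv; rewrite subr_gt0 => /(_ C'v).
move=> [r /= r0 rP].
pose m := Num.min (r / 2) (d / 2).
have m0 : 0 < m by rewrite !lt_min !divr_gt0.
have [mr md] : m <= r / 2 /\ m <= d / 2 by rewrite /m !ge_min !lexx !orbT.
pose j s := k s - l * (s - x) - C' * (s - x) ^+ 2.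
have dj s : x <= s <= x + m -> is_derive s 1 j (dk s - l - 2 * C' * (s - x)).
  move=> /andP[xs sm].
  have ds : is_derive s 1 k (dk s).
    have := dkP (s - x); rewrite (_ : x + (s - x) = s); last by ring.
    by apply; rewrite ger0_norm; lra.
  rewrite /j; apply: is_derive_eq.
  rewrite /GRing.scale/=; ring.
have cj : {within `[x, x + m], continuous j}.
  apply: derivable_within_continuous => s; rewrite in_itv/= => /dj.
  by case.
have xm : x < x + m by lra.
have dj' s : s \in `]x, (x + m)[ -> is_derive s 1 j (dk s - l - 2 * C' * (s - x)).
  by rewrite in_itv/= => /andP[/ltW xs /ltW sm]; apply: dj; rewrite xs sm.
have [c] := MVT xm dj' cj.
rewrite in_itv/= => /andP[xc cm] jE.
have cx0 : 0 < c - x by lra.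
have cxN0 : c - x != 0 by rewrite gt_eqF.
have := rP (c - x); rewrite /ball/= sub0r normrN gtr0_norm//.
rewrite (_ : c - x < r); last by lra.
move=> /(_ isT cxN0); rewrite /GRing.scale/= mulr1 subrK dkl ltr_distl => /andP[_ H].
have {}H : 2 * C' * (c - x) < dk c - l.
  rewrite -ltr_pdivlMr// mulrC; lra.
have : 0 < j (x + m) - j x.
  by rewrite jE mulr_gt0//; lra.
have := kP m; rewrite gtr0_norm// => /(_ ltac:(lra)).
rewrite /j subrr expr0n/= !mulr0 !subr0 (_ : x + m - x = m); last by ring.
have : 0 < m ^+ 2 by rewrite exprn_gt0.
by move: (m ^+ 2) => M; nra.
Qed.

End derivative_tests.

Section jet_algebra.
Context {R : realType}.
Implicit Types (F G : R * R -> R) (z c : R * R).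

Lemma jetB F Fx Fxx Ft G Gx Gxx Gt z :
  jet F Fx Fxx Ft z -> jet G Gx Gxx Gt z ->
  jet (fun z => F z - G z) (fun z => Fx z - Gx z) (fun z => Fxx z - Gxx z)
    (fun z => Ft z - Gt z) z.
Proof.
move=> [cF dF ddF tF] [cG dG ddG tG]; split.
- exact: cvgB.
- by have H := is_deriveB dF dG; exact: H.
- by have H := is_deriveB ddF ddG; exact: H.
- by have H := is_deriveB tF tG; exact: H.
Qed.

Lemma jetZ (k : R) F Fx Fxx Ft z : jet F Fx Fxx Ft z ->
  jet (fun z => k * F z) (fun z => k * Fx z) (fun z => k * Fxx z)
    (fun z => k * Ft z) z.
Proof.
move=> [cF dF ddF tF]; split.
- by apply: cvgM => //; exact: cvg_cst.
- by have H := @is_deriveZ _ _ _ _ k _ _ _ dF; exact: H.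
- by have H := @is_deriveZ _ _ _ _ k _ _ _ ddF; exact: H.
- by have H := @is_deriveZ _ _ _ _ k _ _ _ tF; exact: H.
Qed.

Lemma is_derive_affine (k l x : R) : is_derive x 1 (fun s : R => k + l * s) l.
Proof.
have H := is_deriveD (is_derive_cst k x 1) (@is_deriveZ _ _ _ _ l _ _ _ (is_derive_id x 1)).
by apply: is_derive_eq H _; rewrite add0r; exact: mulr1.
Qed.

Lemma jet_affine (k l m : R) z :
  jet (fun z => k + l * z.1 + m * z.2) (fun=> l) (fun=> 0) (fun=> m) z.
Proof.
split.
- exact/differentiable_continuous/differentiable_affine.
- rewrite (_ : (fun s => _) = (fun s => (k + m * z.2) + l * s)); first exact: is_derive_affine.
  by apply/funext => s /=; ring.
- exact: is_derive_cst.
- exact: (is_derive_affine (k + l * z.1) m).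
Qed.

Lemma jet_shift c F Fx Fxx Ft z : jet F Fx Fxx Ft (c + z) ->
  jet (fun z => F (c + z)) (fun z => Fx (c + z)) (fun z => Fxx (c + z))
    (fun z => Ft (c + z)) z.
Proof.
have sh (k : R -> R) (b x v : R) : is_derive (b + x) 1 k v ->
    is_derive x 1 (fun s => k (b + s)) v.
  move=> kv; have db : is_derive x 1 (fun s => b + s) 1.
    by rewrite (_ : (fun s => _) = (fun s => b + 1 * s));
      [exact: is_derive_affine|apply/funext => s; rewrite mul1r].
  by have H := is_derive1_comp kv db; apply: is_derive_eq H _; rewrite mulr1.
move=> [cF dF ddF tF]; split.
- apply: (@continuous_comp _ _ _ (fun z => c + z) F); last exact: cF.
  by apply: cvgD; [exact: cvg_cst|exact: cvg_id].
- exact: (sh (fun s => F (s, c.2 + z.2))).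
- exact: (sh (fun s => Fx (s, c.2 + z.2))).
- exact: (sh (fun s => F (c.1 + z.1, s))).
Qed.

End jet_algebra.

Section maximum_principle.
Context {R : realType}.
Implicit Types (f : R * R -> R) (z : R * R).

(** A subsolution in the sense of uniform limits. The radius [rho] is fixed before [eps], so that
    all approximants live on one common square. *)
Definition approx_sub (a b r c : R) f z0 : Prop :=
  exists2 rho, 0 < rho & forall eps, 0 < eps -> exists F Fx Fxx Ft,
    forall z, box z0 rho z -> [/\ jet F Fx Fxx Ft z, `|F z - f z| <= eps &
      Ft z - (a * Fxx z + b * Fx z - r * F z) <= c].

(* The approximants of [f - th |z - z0|^2] have a maximum near [z0], over the part
   of a box that precedes the time of [z0]. *)
Lemma local_max (a b r c : R) f z0 (d : R) : 0 <= a -> 0 <= r ->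
  approx_sub a b r c f z0 -> 0 < d ->
  (forall z, box z0 d z -> z.2 <= z0.2 -> f z <= f z0) ->
  r * f z0 <= c.
Proof.
move=> a0 r0 [rho0 rho00 fF] d0 fz0.
pose rho := Num.min (Num.min (rho0 / 2) (d / 2)) 1.
have rho_gt0 : 0 < rho by rewrite !lt_min !divr_gt0/=.
have [rrho0 [rd r1]] : rho <= rho0 / 2 /\ rho <= d / 2 /\ rho <= 1.
  by rewrite /rho !ge_min !lexx !orbT.
(* The factor of [th] collects the contributions of the penalty to [Ft], [Fxx] and [Fx], where
   [rho <= 1] is used, and that of the error [eps <= th] to [r * F]. Then [th] tends to [0]. *)
suff H th : 0 < th -> r * f z0 <= c + th * (2 + 2 * a + 2 * `|b| + r).
  rewrite leNgt; apply/negP => cf.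
  pose M := 2 + 2 * a + 2 * `|b| + r.
  have M0 : 0 < M by rewrite /M; have := normr_ge0 b; lra.
  have := H ((r * f z0 - c) / 2 / M); rewrite -/M divfK ?gt_eqF//.
  by rewrite !divr_gt0 ?subr_gt0// => /(_ isT); lra.
(* An approximation within [eps] leaves a penalty of at most [2 * eps] at the maximum, that is, a
   squared distance to [z0] of at most [rho ^+ 2 / 2]. So the maximum avoids every side of the box
   except the one at the time of [z0]. *)
move=> th0; pose eps := th * rho ^+ 2 / 4.
have rho2 : rho ^+ 2 <= 1 by rewrite expr2; nra.
have eps0 : 0 < eps by rewrite !divr_gt0 ?mulr_gt0 ?exprn_gt0.
have eps_th : eps <= th.
  by rewrite /eps -mulrA ler_piMr ?(ltW th0)//; clear - rho2; lra.
have [F [Fx [Fxx [Ft FP]]]] := fF eps eps0.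
pose N : set (R * R) :=
  `[z0.1 - rho, z0.1 + rho]%classic `*` `[z0.2 - rho, z0.2]%classic.
have NP z : N z -> `|z.1 - z0.1| <= rho /\ `|z.2 - z0.2| <= rho /\ z.2 <= z0.2.
  move=> []; rewrite /= !in_itv/= => /andP[? ?] /andP[? ?].
  by rewrite !ler_norml; split; [|split] => //; apply/andP; split; lra.
have Nrho0 z : N z -> box z0 rho0 z.
  by move=> /NP[? [? _]]; split; lra.
have Nd z : N z -> box z0 d z.
  by move=> /NP[? [? _]]; split; lra.
have Nz0 : N z0 by split; rewrite /= in_itv/=; apply/andP; split; lra.
have cN : compact N by apply: compact_setX; exact: segment_compact.
pose pen z := th * ((z.1 - z0.1) ^+ 2 + (z.2 - z0.2) ^+ 2).
pose G z := F z - pen z.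
have cG : {within N, continuous G}.
  apply: continuous_in_subspaceT => z /set_mem Nz.
  have [[cF _ _ _] _ _] := FP z (Nrho0 z Nz).
  apply: cvgB => //; apply: cvgM; first exact: cvg_cst.
  apply: cvgD; rewrite !expr2.
    by apply: cvgM; apply: cvgB; [exact: cvg_fst|exact: cvg_cst|exact: cvg_fst|exact: cvg_cst].
  by apply: cvgM; apply: cvgB; [exact: cvg_snd|exact: cvg_cst|exact: cvg_snd|exact: cvg_cst].
have [z2 /set_mem Nz2 z2P] := compact_EVT_max (ex_intro _ z0 Nz0) cN cG.
have Gmax z : N z -> G z <= G z2 by move=> Nz; apply: z2P; exact: mem_set.
have [_ Ff0 _] := FP z0 (Nrho0 _ Nz0).
have [[_ dFx dFxx dFt] Ff2 ineq] := FP z2 (Nrho0 _ Nz2).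
have G0 : f z0 - eps <= G z2.
  apply: le_trans (Gmax _ Nz0); rewrite /G /pen !subrr expr0n/= addr0 mulr0 subr0.
  by move: Ff0; rewrite ler_distl => /andP[].
have [z21 [z22 z22']] := NP _ Nz2.
have f2 := fz0 _ (Nd _ Nz2) z22'.
have pen2 : pen z2 <= 2 * eps.
  move: Ff2; rewrite ler_distl => /andP[_ Ff2].
  by move: G0; rewrite /G; lra.
have dist2 : (z2.1 - z0.1) ^+ 2 + (z2.2 - z0.2) ^+ 2 <= rho ^+ 2 / 2.
  by rewrite -(ler_pM2l th0); move: pen2; rewrite /pen /eps; lra.
have F2 : f z0 - eps <= F z2.
  have : 0 <= pen z2 by apply: mulr_ge0; rewrite ?(ltW th0)// addr_ge0 ?sqr_ge0.
  by move: G0; rewrite /G; lra.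
have x2 : `|z2.1 - z0.1| < rho.
  rewrite -(ltr_pXn2r (n := 2)) ?nnegrE// ?(ltW rho_gt0)//.
  rewrite real_normK ?num_real//.
  have := sqr_ge0 (z2.2 - z0.2); have : 0 < rho ^+ 2 by rewrite exprn_gt0.
  by lra.
have t2 : `|z2.2 - z0.2| < rho.
  rewrite -(ltr_pXn2r (n := 2)) ?nnegrE// ?(ltW rho_gt0)//.
  rewrite real_normK ?num_real//.
  have := sqr_ge0 (z2.1 - z0.1); have : 0 < rho ^+ 2 by rewrite exprn_gt0.
  by lra.
(* The maximum may lie at the time of [z0], so it is compared with earlier times only; this bounds
   [Ft] from below, which is the side that is needed. *)
have Ftge : 2 * th * (z2.2 - z0.2) <= Ft z2.
  apply: (@one_sided_derive_ge _ (fun t => F (z2.1, t)) z2.2 (-1) _ th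
    (rho - `|z2.2 - z0.2|) _ _ _ _ dFt).
  - by rewrite normrN1.
  - by rewrite subr_gt0.
  - move=> h /andP[h0 hr].
    have Nh : N (z2.1, z2.2 + -1 * h).
      split; rewrite /= in_itv/=; apply/andP.
        by move: z21; clear; rewrite ler_norml => /andP[]; split; lra.
      split; last by lra.
      have := ler_norm (- (z2.2 - z0.2)); rewrite normrN; lra.
    by have := Gmax _ Nh; rewrite /G /pen/= -surjective_pairing; lra.
pose dx := rho - `|z2.1 - z0.1|.
have dx0 : 0 < dx by rewrite subr_gt0.
have Nx h : `|h| < dx -> N (z2.1 + h, z2.2).
  move=> hd; split; rewrite /= in_itv/=; apply/andP.
    have : `|(z2.1 - z0.1) + h| <= rho.
      by apply: le_trans (ler_normD _ _) _; rewrite /dx in hd; lra.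
    by clear; rewrite ler_norml => /andP[]; split; lra.
  by move: z22 z22'; clear; rewrite ler_norml => /andP[]; split; lra.
have [] := @second_derive_le _ (fun s => F (s, z2.2))
  (fun s => Fx (s, z2.2)) z2.1 (2 * th * (z2.1 - z0.1)) th dx (Fxx z2) dx0.
- by move=> h hd; have [[]] := FP _ (Nrho0 _ (Nx h hd)).
- move=> h hd.
  by have := Gmax _ (Nx h hd); rewrite /G /pen/= -surjective_pairing; lra.
rewrite -surjective_pairing => FxE Fxxle.
have H1 : - (2 * th) <= Ft z2.
  apply: le_trans Ftge.
  have : - 1 <= z2.2 - z0.2 by have := ler_norm (- (z2.2 - z0.2)); rewrite normrN; lra.
  by move=> h; rewrite -mulrN1 ler_wpM2l// mulr_ge0// ltW.
have H2 : a * Fxx z2 <= a * (2 * th) by rewrite ler_wpM2l.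
have H3 : b * Fx z2 <= `|b| * (2 * th).
  apply: le_trans (ler_norm _) _; rewrite normrM FxE ler_wpM2l//.
  rewrite normrM (gtr0_norm (mulr_gt0 (ltr0Sn _ 1) th0)).
  by rewrite ler_piMr ?mulr_ge0 ?(ltW th0)//; exact: le_trans (ltW x2) r1.
have H4 : r * (f z0 - eps) <= r * F z2 by rewrite ler_wpM2l.
have H5 := ler_wpM2l r0 eps_th.
by rewrite mulrBr in H4; clear - H1 H2 H3 H4 H5 ineq; lra.
Qed.

(* Subtracting [de (xb - x + |b| t)] makes the supremum attained on the unbounded
   domain, at the cost of an error that has the right sign. *)
Lemma max_principle (a b r xb t1 M : R) f : 0 <= a -> 0 < r ->
  continuous f ->
  (forall z, z.1 <= xb -> 0 <= z.2 <= t1 -> f z <= M) ->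
  (forall t, 0 <= t <= t1 -> f (xb, t) <= 0) ->
  (forall x, x <= xb -> f (x, 0) <= 0) ->
  (forall z, z.1 < xb -> 0 < z.2 <= t1 -> 0 < f z -> approx_sub a b r 0 f z) ->
  forall z, z.1 <= xb -> 0 <= z.2 <= t1 -> f z <= 0.
Proof.
move=> a0 r0 cf fM fxb f0 fsub z1 z1x /andP[z10 z1t].
rewrite leNgt; apply/negP => fz1.
pose P0 z := xb - z.1 + `|b| * z.2.
have P00 z : z.1 <= xb -> 0 <= z.2 -> 0 <= P0 z.
  by move=> zx z0; rewrite addr_ge0 ?subr_ge0// mulr_ge0.
have p1 := P00 _ z1x z10.
(* Chosen so that the correction at [z1] is below [f z1], which keeps [g z1] positive. *)
pose de := f z1 / (2 * (P0 z1 + 1)).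
have de0 : 0 < de by rewrite divr_gt0// mulr_gt0//; lra.
pose g z := f z - de * P0 z.
have gz1 : 0 < g z1.
  rewrite /g subr_gt0 /de mulrAC ltr_pdivrMr; last by lra.
  by rewrite ltr_pM2l//; lra.
(* At [x = xb - L] the correction already exceeds the bound [M] of [f], so a positive maximum of [g]
   cannot sit there. *)
pose L := Num.max (xb - z1.1) (M / de).
have [L1 L2] : xb - z1.1 <= L /\ M / de <= L by rewrite /L !le_max !lexx orbT.
pose N : set (R * R) := `[xb - L, xb]%classic `*` `[0, t1]%classic.
have cN : compact N by apply: compact_setX; exact: segment_compact.
have Nz1 : N z1 by split; rewrite /= in_itv/=; apply/andP; split => //; lra.
have cg : continuous g.
  move=> z; apply: cvgB; first exact: cf.
  apply: cvgM; first exact: cvg_cst.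
  apply: cvgD; first by apply: cvgB; [exact: cvg_cst|exact: cvg_fst].
  by apply: cvgM; [exact: cvg_cst|exact: cvg_snd].
have [z0 /set_mem Nz0 z0P] := compact_EVT_max (ex_intro _ z1 Nz1) cN (continuous_subspaceT cg).
have gz0 : 0 < g z0 by apply: lt_le_trans gz1 (z0P _ (mem_set Nz1)).
move: Nz0 => []; rewrite /= !in_itv/= => /andP[xL zxb] /andP[t0 tt1].
have Pz0 := P00 _ zxb t0.
have dPz0 : 0 <= de * P0 z0 by rewrite mulr_ge0// ltW.
have fz0 : 0 < f z0 by move: gz0; rewrite /g; lra.
have {}zxb : z0.1 < xb.
  rewrite lt_neqAle zxb andbT; apply/eqP => E.
  have := fxb z0.2; rewrite t0 tt1 => /(_ isT); rewrite -E -surjective_pairing; lra.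
have {}t0 : 0 < z0.2.
  rewrite lt_neqAle t0 andbT; apply/eqP => E.
  by have := f0 z0.1 (ltW zxb); rewrite [X in (_, X)]E -surjective_pairing; lra.
have {}xL : xb - L < z0.1.
  rewrite lt_neqAle xL andbT; apply/eqP => E.
  have : f z0 <= M by apply: fM; [exact: ltW|rewrite tt1 ltW].
  have : M <= de * P0 z0.
    rewrite mulrC -ler_pdivrMr//; apply: le_trans L2 _.
    by rewrite /P0 -E; have := mulr_ge0 (normr_ge0 b) (ltW t0); lra.
  by move: gz0; rewrite /g; lra.
have gmax z : z.1 <= xb -> xb - L <= z.1 -> 0 <= z.2 -> z.2 <= t1 -> g z <= g z0.
  by move=> ? ? ? ?; apply: z0P; rewrite inE; split; rewrite /= in_itv/=; apply/andP; split.
have : r * g z0 <= 0.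
  pose d := Num.min (xb - z0.1) (Num.min (z0.1 - (xb - L)) z0.2).
  have d0 : 0 < d by rewrite !lt_min !subr_gt0 zxb xL t0.
  have [d1 [d2 d3]] : d <= xb - z0.1 /\ d <= z0.1 - (xb - L) /\ d <= z0.2.
    by rewrite /d !ge_min !lexx !orbT.
  have nb z : box z0 d z -> [/\ z.1 < xb, xb - L < z.1 & 0 < z.2].
    clear - d1 d2 d3 => -[]; rewrite !ltr_norml => /andP[? ?] /andP[? ?].
    by split; lra.
  apply: (@local_max a b r 0 g z0 d) => //; first exact: ltW.
    have := fsub z0 zxb; rewrite t0 tt1 => /(_ isT fz0) [rho rho0 fF].
    exists (Num.min rho d); first by rewrite lt_min rho0.
    move=> eps eps0; have [F [Fx [Fxx [Ft FP]]]] := fF eps eps0.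
    exists (fun z => F z - (de * xb + - de * z.1 + (de * `|b|) * z.2)),
      (fun z => Fx z - - de), (fun z => Fxx z - 0), (fun z => Ft z - de * `|b|).
    move=> z [b1 b2].
    move: b1 b2; rewrite lt_min => /andP[b1 b1d]; rewrite lt_min => /andP[b2 b2d].
    have zr : box z0 rho z by [].
    have zd : box z0 d z by [].
    have [zx zL zt] := nb z zd.
    have [jF Ff ineq] := FP z zr.
    have PE : de * xb + - de * z.1 + de * `|b| * z.2 = de * P0 z by rewrite /P0; ring.
    split.
    - exact: jetB jF (jet_affine _ _ _ _).
    - by rewrite PE /g opprB addrA subrK.
    - rewrite PE.
      have : 0 <= r * (de * P0 z) by apply: mulr_ge0 (ltW r0) _; apply: mulr_ge0 (ltW de0) (P00 _ (ltW zx) (ltW zt)).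
      have : - b * de <= `|b| * de by rewrite -normrN ler_wpM2r ?ler_norm// ltW.
      by move: ineq; move: (P0 z) => p; lra.
  move=> z /nb[/ltW zx /ltW zL /ltW zt'] zt.
  by apply: gmax => //; exact: le_trans tt1.
by rewrite leNgt mulr_gt0.
Qed.

End maximum_principle.

(** * Mollified strong solutions *)

Section strong_solution_approximation.
Context {R : realType}.
Local Notation mR := (measurableTypeR R).
Implicit Types (u w g : R * R -> R) (z v y c : R * R) (K : set (mR * mR)) (e d : R).

Lemma convol_linear K u w g z (k : R) : measurable K ->
  (lebesgue2 R).-integrable K (EFin \o u) ->
  (lebesgue2 R).-integrable K (EFin \o w) -> flat_expr g ->
  convol K (fun y => u y + k * w y) g z = convol K u g z + k * convol K w g z.
Proof.
move=> mK iu iw Fg; rewrite /convol.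
have iug := integrable_mul_flat_expr z mK iu Fg.
have iwg := integrable_mul_flat_expr z mK iw Fg.
rewrite -RintegralZl// -RintegralD//; last exact: (integrableZl mK k iwg).
by apply: eq_Rintegral => y _; ring.
Qed.

Lemma integrable_linear K u w (k : R) : measurable K ->
  (lebesgue2 R).-integrable K (EFin \o u) ->
  (lebesgue2 R).-integrable K (EFin \o w) ->
  (lebesgue2 R).-integrable K (EFin \o (fun y => u y + k * w y)).
Proof. by move=> mK iu iw; exact: (integrableD mK iu (integrableZl mK k iw)). Qed.

Lemma ae_lebesgue2S (P Q : R * R -> Prop) : (forall y, P y -> Q y) ->
  {ae lebesgue2 R, forall y, P y} -> {ae lebesgue2 R, forall y, Q y}.
Proof. by move=> PQ; apply: negligibleS => y /= nQ Py; apply/nQ/PQ. Qed.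

Lemma convol_ae K u w g z : measurable K ->
  (lebesgue2 R).-integrable K (EFin \o u) ->
  (lebesgue2 R).-integrable K (EFin \o w) -> flat_expr g ->
  {ae lebesgue2 R, forall y, K y -> u y = w y} ->
  convol K u g z = convol K w g z.
Proof.
move=> mK iu iw Fg uw; rewrite /convol /Rintegral; congr fine.
apply: ae_eq_integral => //.
- exact: measurable_int (integrable_mul_flat_expr z mK iu Fg).
- exact: measurable_int (integrable_mul_flat_expr z mK iw Fg).
- by apply: ae_lebesgue2S uw => y uwy Ky; rewrite /= uwy.
Qed.

Lemma convol_ge0 K u e z : 0 < e -> (forall y, K y -> 0 <= u y) ->
  0 <= convol K u (mollifier e) z.
Proof.
by move=> e0 u0; apply: Rintegral_ge0 => y Ky; rewrite mulr_ge0 ?mollifier_ge0// u0.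
Qed.

Lemma convol_ae_ge0 K u e z : measurable K -> 0 < e ->
  (lebesgue2 R).-integrable K (EFin \o u) ->
  {ae lebesgue2 R, forall y, K y -> 0 <= u y} ->
  0 <= convol K u (mollifier e) z.
Proof.
move=> mK e0 iu u0.
(* An almost everywhere nonnegative function agrees almost everywhere with its absolute value, which
   is nonnegative at every point. *)
rewrite (@convol_ae K u (fun y => `|u y|))//.
- exact: convol_ge0.
- exact: integrable_norm.
- exact: flat_expr_mollifier.
- by apply: ae_lebesgue2S u0 => y uy Ky; rewrite ger0_norm// uy.
Qed.

Lemma is_derive_expR_mul (a : R) (k : R -> R) (c d : R) :
  k 0 = c -> is_derive (0 : R) 1 k d ->
  is_derive (0 : R) 1 (fun h => expR (a * h) * k h) (d + a * c).
Proof.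
move=> <- dk; have d1 : is_derive (0 : R) 1 (fun h : R => expR (a * h)) a.
  have dr : is_derive (0 : R) 1 (fun h => a * h) a.
    rewrite (_ : (fun h => _) = (fun h => 0 + a * h)); first exact: is_derive_affine.
    by apply/funext => h; rewrite add0r.
  have H1 := is_derive1_comp (is_derive_expR (a * 0)) dr.
  by apply: is_derive_eq H1 _; rewrite mulr0 expR0 mul1r.
have H1 := is_deriveM d1 dk; apply: is_derive_eq H1 _.
by rewrite mulr0 expR0 /GRing.scale/=; ring.
Qed.

(** The properties are stated for one and the same approximant, because the comparison of
    volatilities combines the equation and the first-order inequality at a single point. The last
    one turns a translation inequality with error [C * h ^+ 2] into a differential inequality. *)
Lemma strong_solution_approx (K1 k1 K2 r q T sigma p : R) (Y u : R * R -> R)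
    z0 (rho : R) :
  strong_solution K1 k1 K2 r q T sigma p Y -> continuous u ->
  (forall y, open_domain k1 T y -> u y = Y y) -> 0 < rho ->
  cbox z0 (2 * rho) `<=` open_domain k1 T ->
  forall eps, 0 < eps -> exists F Fx Fxx Ft, forall z, box z0 rho z ->
  [/\ jet F Fx Fxx Ft z, `|F z - u z| <= eps,
      0 <= Ft z - opL r q sigma (F z) (Fx z) (Fxx z),
      (forall y, cbox z0 (2 * rho) y -> psi1 K1 k1 K2 y.1 < u y) ->
        Ft z - opL r q sigma (F z) (Fx z) (Fxx z) = 0 &
      forall C h0, 0 < h0 -> (forall h y, 0 < h < h0 -> cbox z0 (2 * rho) y ->
          u y <= expR (r * h) * u (h *: (- (r - q), 1) + y) + C * h ^+ 2) ->
        0 <= Ft z - (r - q) * Fx z + r * F z].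
Proof.
move=> [_ _ [Yx [Yxx [Yt [[wx wxx wt] sup sol]]]] _ _] cu uY rho0 KO eps eps0.
pose K : set (mR * mR) := cbox z0 (2 * rho).
have mK : measurable K by exact: measurable_cbox.
have cK : compact (cbox z0 (2 * rho)) by exact: compact_cbox.
have [iY iYx] : (lebesgue2 R).-integrable K (EFin \o Y) /\
    (lebesgue2 R).-integrable K (EFin \o Yx).
  by case: wx => iY iYx _; split; [exact: iY|exact: iYx].
have iYxx : (lebesgue2 R).-integrable K (EFin \o Yxx) by case: wxx => _ + _; apply.
have iYt : (lebesgue2 R).-integrable K (EFin \o Yt) by case: wt => _ + _; apply.
have i1 : (lebesgue2 R).-integrable K (EFin \o cst 1).
  by apply: integrable_cst_cbox; rewrite mulr_gt0.
have KQ y : K y -> domain k1 T y.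
  by move=> /KO [y1 /andP[y2 /ltW y3]]; split => //; apply/andP; split.
have [e0 e00 ue] := uniform_continuity_cbox (fun y (_ : cbox z0 rho y) => cu y) eps0.
(* A kernel of radius at most [rho] centred in the square of half side [rho] only sees values in the
   square [K] of twice that size. *)
pose e := Num.min e0 rho.
have e_gt0 : 0 < e by rewrite lt_min e00.
have [ee0 erho] : e <= e0 /\ e <= rho by rewrite /e !ge_min !lexx orbT.
pose g := @mollifier R e.
have Fg : flat_expr g by exact: flat_expr_mollifier.
have zK z : box z0 rho z -> box z e `<=` K.
  move=> [z1 z2] y [y1 y2]; split.
    by rewrite -[_ - _](subrKA z.1); apply: le_trans (ler_normD _ _) _; lra.
  by rewrite -[_ - _](subrKA z.2); apply: le_trans (ler_normD _ _) _; lra.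
exists (convol K Y g), (convol K Y (iter_derive [:: dir_x] g)),
  (convol K Y (iter_derive [:: dir_x; dir_x] g)),
  (convol K Y (iter_derive [:: dir_tau] g)) => z zrho.
have g0 y : ~ cbox z0 (2 * rho) y -> g (z - y) = 0.
  by move=> Ky; apply: mollifier_eq0 => /(zK z zrho).
pose H := fun y => Yt y - opL r q sigma (Y y) (Yx y) (Yxx y).
pose a := sigma ^+ 2 / 2.
pose b := r - q - a.
pose H' := fun y => ((Yt y + (- a) * Yxx y) + (- b) * Yx y) + r * Y y.
have HE : H = H' by apply/funext => y; rewrite /H /H' /opL /b /a; ring.
have iH : (lebesgue2 R).-integrable K (EFin \o H).
  rewrite HE; apply: integrable_linear => //; apply: integrable_linear => //.
  exact: integrable_linear.
(* Since the coefficients are constant, the residual of the mollified function is the mollified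
   residual. *)
have opE : convol K Y (iter_derive [:: dir_tau] g) z -
    opL r q sigma (convol K Y g z) (convol K Y (iter_derive [:: dir_x] g) z)
      (convol K Y (iter_derive [:: dir_x; dir_x] g) z) = convol K H g z.
  have opL_congr A A' B B' C C' D : A = A' -> B = B' -> C = C' ->
    A - opL r q sigma D B C = A' - opL r q sigma D B' C' by move=> -> -> ->.
  apply: etrans (opL_congr _ _ _ _ _ _ _ (weak_convol wt Fg cK mK KO g0)
    (weak_convol wx Fg cK mK KO g0) (weak_convol wxx Fg cK mK KO g0)) _.
  rewrite HE.
  have i2 := integrable_linear (- a) mK iYt iYxx.
  have i3 := integrable_linear (- b) mK i2 iYx.
  rewrite (convol_linear z r mK i3 iY Fg) (convol_linear z (- b) mK i2 iYx Fg).
  rewrite (convol_linear z (- a) mK iYt iYxx Fg) /opL /b /a.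
  move: (convol K Yt g z) (convol K Yxx g z) (convol K Yx g z) (convol K Y g z).
  by move=> c1 c2 c3 c4; ring.
split.
- exact: (jet_convol z mK iY Fg).
- apply: convol_near => //; first exact: zK.
  move=> y zy; rewrite -uY; last exact: KO (zK z zrho y zy).
  apply: (ue z y); first by case: zrho => /ltW ? /ltW ?.
  by case: zy => y1 y2; split; lra.
- rewrite opE; apply: convol_ae_ge0 => //.
  by apply: ae_lebesgue2S sup => y + /KQ; exact.
- move=> psiu; rewrite opE (@convol_ae K H (cst 0))//.
  + exact: convol_cst (zK z zrho) _ i1.
  + by have := integrable_cst_cbox z0 0 (_ : 0 < 2 * rho); apply; rewrite mulr_gt0.
  + apply: ae_lebesgue2S sol => y Hy Ky; apply: Hy (KQ _ Ky) _.
    by rewrite -uY; [exact: psiu|exact: KO].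
- move=> C h0 h00 uh.
  pose dd : R * R := (- (r - q), 1).
  (* The derivative of [k] at [0] is the first-order expression of the goal. The translation
     inequality reads [k 0 <= k h + C * h ^+ 2], so the one-sided test applies with slope [0]. *)
  pose k := fun h : R => expR (r * h) * convol K Y g (z + h *: dd).
  have dk : is_derive (0 : R) 1 k (convol K Y (iter_derive [:: dir_tau] g) z -
     (r - q) * convol K Y (iter_derive [:: dir_x] g) z + r * convol K Y g z).
    have z0E : z + (0 : R) *: dd = z by rewrite scale0r addr0.
    have d2 : is_derive (0 : R) 1 (fun t : R => convol K Y g (z + t *: dd))
        (- (r - q) * convol K Y (iter_derive [:: dir_x] g) z +
         1 * convol K Y (iter_derive [:: dir_tau] g) z).
      have E := convol_derive_coord z dd mK iY Fg.
      have D := is_derive_line (is_derive_convol (z + 0 *: dd) dd mK iY Fg).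
      by apply: is_derive_eq D _; rewrite z0E; exact: E.
    have alg (c1 c2 c3 : R) : (- (r - q) * c1 + 1 * c2) + r * c3 =
      c2 - (r - q) * c1 + r * c3 by ring.
    have k0 : convol K Y g (z + (0 : R) *: dd) = convol K Y g z by rewrite z0E.
    exact: (is_derive_eq (is_derive_expR_mul r k0 d2) (alg _ _ _)).
  have [z1 z2] := zrho.
  pose m := `|r - q| + 1; have m0 : 0 < m by rewrite ltr_wpDl.
  (* For [h < h1] the translate of [z] stays in the square of half side [rho], since [m] bounds the
     horizontal speed [|r - q|]. *)
  pose h1 := Num.min h0 (Num.min ((rho - `|z.1 - z0.1|) / m) (rho - `|z.2 - z0.2|)).
  have h10 : 0 < h1 by rewrite !lt_min h00 divr_gt0 ?subr_gt0.
  have [h1a [h1b h1c]] : h1 <= h0 /\ h1 <= (rho - `|z.1 - z0.1|) / m /\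
      h1 <= rho - `|z.2 - z0.2| by rewrite /h1 !ge_min !lexx !orbT.
  apply: (@one_sided_derive_ge _ k (0 : R) 1 0 C h1 _ (normr1 _) h10 _ dk) => h /andP[hp hh1].
  rewrite mul0r sub0r !mul1r add0r /k mulr0 expR0 mul1r scale0r addr0.
  have zh : box z0 rho (h *: dd + z).
    split; rewrite /dd /= /GRing.scale/=.
      rewrite -addrA; apply: le_lt_trans (ler_normD _ _) _.
      rewrite normrM normrN (gtr0_norm hp).
      have : h * m < rho - `|z.1 - z0.1|.
        by rewrite -ltr_pdivlMr//; apply: lt_le_trans hh1 _.
      by rewrite /m; clear - hp; lra.
    rewrite mulr1 -addrA; apply: le_lt_trans (ler_normD _ _) _.
    by rewrite (gtr0_norm hp); lra.
  have : convol K Y g z <= expR (r * h) * convol K Y g (h *: dd + z) + C * h ^+ 2.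
    apply: (convol_shift mK (zK z zrho) (zK _ zh) e_gt0 i1 iY) => y zy.
    have Ky := zK z zrho y zy.
    have Khy : K (h *: dd + y).
      apply: (zK _ zh); case: zy => y1 y2.
      have E1 : (h *: dd + y).1 - (h *: dd + z).1 = y.1 - z.1 by rewrite /=; ring.
      have E2 : (h *: dd + y).2 - (h *: dd + z).2 = y.2 - z.2 by rewrite /=; ring.
      by split; rewrite ?E1 ?E2.
    rewrite -(uY _ (KO _ Ky)) -(uY _ (KO _ Khy)); apply: uh => //.
    by rewrite hp; apply: lt_le_trans hh1 _.
  by move=> H2; rewrite [z + _]addrC lerBrDl lerBlDr; exact: H2.
Qed.

End strong_solution_approximation.

(** * Comparison of solutions *)

Section extension.
Context {R : realType}.

(** Composing with this coordinatewise retraction extends [Y] to a continuous function on the plane,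
    so that mollification and translation can be stated without tracking the domain. *)
Definition clamp (k1 T : R) (z : R * R) : R * R :=
  (Num.min z.1 (ln k1), Num.min (Num.max z.2 0) T).

Lemma clamp_closed_domain (k1 T : R) z : 0 < T -> closed_domain k1 T (clamp k1 T z).
Proof.
move=> T0; split=> /=; first by rewrite ge_min lexx orbT.
by rewrite le_min le_max lexx orbT ge_min lexx orbT !andbT ltW.
Qed.

Lemma clamp_id (k1 T : R) z : closed_domain k1 T z -> clamp k1 T z = z.
Proof.
case: z => x t [/= x1 /andP[t0 tT]]; rewrite /clamp /=.
by congr (_, _); rewrite ?(max_idPl t0); exact/min_idPl.
Qed.

Lemma ltr_dist_min (a b c d : R) :
  `|a - b| < d -> `|Num.min a c - Num.min b c| < d.
Proof.
move=> H; have d0 : 0 < d := le_lt_trans (normr_ge0 _) H.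
move: H; rewrite !ltr_norml => /andP[? ?].
by case: (lerP a c) => ?; case: (lerP b c) => ?; apply/andP; split; lra.
Qed.

Lemma ltr_dist_max (a b c d : R) :
  `|a - b| < d -> `|Num.max a c - Num.max b c| < d.
Proof.
move=> H; have d0 : 0 < d := le_lt_trans (normr_ge0 _) H.
move: H; rewrite !ltr_norml => /andP[? ?].
by case: (lerP a c) => ?; case: (lerP b c) => ?; apply/andP; split; lra.
Qed.

Lemma continuous_comp_clamp (k1 T : R) (Y : R * R -> R) : 0 < T ->
  {within closed_domain k1 T, continuous Y} -> continuous (Y \o clamp k1 T).
Proof.
move=> T0 /subspace_continuousP cY z; apply/continuous_boxP => e e0.
have /cvgrPdist_le/(_ _ e0) := cY _ (clamp_closed_domain k1 z T0).
rewrite near_withinE => /nbhs_boxP[d d0 dP]; exists d => // y [y1 y2].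
rewrite /= distrC; apply: dP; last exact: clamp_closed_domain.
by split; [exact: ltr_dist_min|exact/ltr_dist_min/ltr_dist_max].
Qed.

End extension.

Section exponential_bounds.
Context {R : realType}.
Implicit Types y : R.

(** From [1 + y <= exp y] and [(1 - y + y^2)(1 + y) = 1 + y^3]. *)
Lemma expRN_le_quad y : 0 <= y -> expR (- y) <= 1 - y + y ^+ 2.
Proof.
move=> y0; rewrite expRN -div1r ler_pdivrMr ?expR_gt0//.
apply: (@le_trans _ _ ((1 - y + y ^+ 2) * (1 + y))).
  have : 0 <= y ^+ 3 by rewrite exprn_ge0.
  by rewrite (_ : (1 - y + y ^+ 2) * (1 + y) = 1 + y ^+ 3); [lra|ring].
rewrite ler_wpM2l ?expR_ge1Dx//.
by have := sqr_ge0 (y - 1); rewrite sqrrB1 expr2; nra.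
Qed.

Lemma expR_le_quad y : 0 <= y -> y <= 1 / 2 -> expR y <= 1 + y + 2 * y ^+ 2.
Proof.
move=> y0 y1; rewrite -[y in expR y]opprK expRN -div1r ler_pdivrMr ?expR_gt0//.
apply: (@le_trans _ _ ((1 + y + 2 * y ^+ 2) * (1 + - y))).
  rewrite (_ : _ * _ = 1 + y ^+ 2 * (1 - 2 * y)); last by ring.
  by rewrite lerDl mulr_ge0 ?sqr_ge0//; lra.
by rewrite ler_wpM2l ?expR_ge1Dx// !addr_ge0// mulr_ge0// sqr_ge0.
Qed.

End exponential_bounds.

(** * Bounds and comparison for the obstacle problem *)

Section obstacle_problem.
Context {R : realType} (K1 k1 K2 r q T p : R).
Context (hK1 : 0 < K1) (hK1k1 : K1 < k1) (hk1K2 : k1 < K2).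
Context (hr : 0 < r) (hq : 0 <= q) (hT : 0 < T).
Implicit Types (x t h : R) (z y : R * R).

Local Notation m := (K1 + k1 - K2).
Local Notation psi := (psi1 K1 k1 K2).

Let k1_gt0 : 0 < k1. Proof. exact: lt_trans hK1k1. Qed.

Lemma psi1_ge_exp x : expR x - m <= psi x.
Proof.
rewrite /psi1; have : expR x - K1 <= Num.max (expR x - K1) 0 by rewrite le_max lexx.
by lra.
Qed.

Lemma psi1_ge_cst x : K2 - k1 <= psi x.
Proof.
rewrite /psi1; have : 0 <= Num.max (expR x - K1) 0 by rewrite le_max lexx orbT.
by lra.
Qed.

Lemma psi1_low x : expR x <= K1 -> psi x = K2 - k1.
Proof. by move=> xK; rewrite /psi1 (max_idPr _) ?add0r// subr_le0. Qed.

Lemma psi1_high x : K1 <= expR x -> psi x = expR x - m.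
Proof. by move=> xK; rewrite /psi1 (max_idPl _) ?subr_ge0//; ring. Qed.

Lemma expR_le_k1 x : x <= ln k1 -> expR x <= k1.
Proof. by rewrite -ler_expR lnK ?posrE. Qed.

Lemma psi1_ln_k1 : psi (ln k1) = K2 - K1.
Proof. by rewrite psi1_high lnK ?posrE// ?ltW//; ring. Qed.

Lemma psi1_le x : x <= ln k1 -> psi x <= K2 - K1.
Proof.
move=> /expR_le_k1 xk; have [xK|xK] := lerP (expR x) K1.
  by rewrite psi1_low//; move: hK1k1; lra.
by rewrite psi1_high ?(ltW xK)//; lra.
Qed.

Lemma continuous_psi1 : continuous (fun z => psi z.1).
Proof.
move=> z; apply: cvgB; last exact: cvg_cst.
apply: cvgD; last exact: cvg_cst.
apply: (@continuous_max _ _ (fun z : R * R => expR z.1 - K1) (cst 0) z); last exact: cvg_cst.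
apply: cvgB; last exact: cvg_cst.
by apply: continuous_comp; [exact: cvg_fst|exact: continuous_expR].
Qed.

Lemma nbhs_cbox z (P : set (R * R)) : nbhs z P ->
  exists2 d, 0 < d & cbox z (2 * d) `<=` P.
Proof.
move=> /nbhs_boxP[d d0 dP]; exists (d / 4); first by rewrite divr_gt0.
by move=> y [y1 y2]; apply: dP; split; lra.
Qed.

Lemma nbhs_open_domain z : open_domain k1 T z -> nbhs z (open_domain k1 T).
Proof.
move=> [zx /andP[z0 zT]]; apply/nbhs_boxP.
exists (Num.min (ln k1 - z.1) (Num.min z.2 (T - z.2))).
  by rewrite !lt_min !subr_gt0 zx z0 zT.
move=> y [+ +]; rewrite !lt_min !ltr_norml.
move=> /andP[/andP[? ?] _] /andP[_ /andP[/andP[? ?] /andP[? ?]]].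
by split; [lra|apply/andP; split; lra].
Qed.

Section one_solution.
Context (sigma : R) (Y : R * R -> R).
Context (sol : bounded_strong_solution K1 k1 K2 r q T sigma p Y).

Local Notation u := (Y \o clamp k1 T).
Local Notation a := (sigma ^+ 2 / 2).
Local Notation b := (r - q - sigma ^+ 2 / 2).

Lemma solution_continuous : continuous u.
Proof. by have [[[cY _] _ _ _ _] _] := sol; exact: continuous_comp_clamp. Qed.

Lemma solution_clampE z : closed_domain k1 T z -> u z = Y z.
Proof. by move=> /clamp_id /= ->. Qed.

Lemma solution_open_domainE z : open_domain k1 T z -> u z = Y z.
Proof.
by move=> [/ltW zx /andP[/ltW z0 /ltW zT]]; rewrite solution_clampE//; split => //; rewrite z0.
Qed.

Lemma solution_ln_k1 t : 0 <= t <= T -> u (ln k1, t) = K2 - K1.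
Proof.
move=> tT; have [[_ _ _ _ bY] _] := sol.
by rewrite solution_clampE ?bY//; split.
Qed.

Lemma solution_init x : x <= ln k1 -> u (x, 0) = psi x.
Proof.
rewrite le_eqVlt => /predU1P[->|xk].
  by rewrite solution_ln_k1 ?lexx ?ltW// psi1_ln_k1.
have [[_ _ _ iY _] _] := sol.
by rewrite solution_clampE ?iY//; split => /=; rewrite ?lexx ltW.
Qed.

Lemma solution_ge_psi1 z : closed_domain k1 T z -> psi z.1 <= u z.
Proof.
case: z => x t [xk tT]; rewrite /= in xk tT.
move: xk; rewrite le_eqVlt => /predU1P[->|xk].
  by rewrite solution_ln_k1// psi1_ln_k1.
have [[_ pY iY _ _] _] := sol.
have [t0|t0] := eqVneq t 0; first by rewrite t0 solution_init// ltW.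
have /andP[t0' tT'] := tT.
rewrite solution_clampE; last by split => //=; exact: ltW.
by apply: (pY (x, t)); split => //=; rewrite tT' lt_neqAle eq_sym t0 t0'.
Qed.

Lemma solution_bounded : exists2 M, 0 <= M & forall z, `|u z| <= M.
Proof.
have [_ [M [_ MP]]] := sol.
have H z : `|u z| <= M + 1 by apply: (MP (M + 1)); [rewrite ltrDl|exact: clamp_closed_domain].
by exists (M + 1) => //; apply: le_trans (H 0).
Qed.

Lemma super_approx z0 : open_domain k1 T z0 ->
  exists2 rho, 0 < rho & forall eps, 0 < eps -> exists F Fx Fxx Ft,
    forall z, box z0 rho z -> [/\ jet F Fx Fxx Ft z, `|F z - u z| <= eps &
      0 <= Ft z - (a * Fxx z + b * Fx z - r * F z)].
Proof.
move=> /nbhs_open_domain /nbhs_cbox[d d0 dO]; exists d => // eps eps0.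
have [F [Fx [Fxx [Ft FP]]]] := strong_solution_approx sol.1 solution_continuous
  solution_open_domainE d0 dO eps0.
by exists F, Fx, Fxx, Ft => z /FP[].
Qed.

Lemma nbhs_above_psi1 z : psi z.1 < u z -> nbhs z [set y | psi y.1 < u y].
Proof.
move=> pu.
have cf : continuous (fun z => u z - psi z.1).
  by move=> y; apply: cvgB; [exact: solution_continuous|exact: continuous_psi1].
have /cvgr_gt/(_ 0) := cf z; rewrite subr_gt0 => /(_ pu).
by apply: filterS => y; rewrite subr_gt0.
Qed.

Lemma exact_approx z0 : open_domain k1 T z0 -> psi z0.1 < u z0 ->
  exists2 rho, 0 < rho & forall eps, 0 < eps -> exists F Fx Fxx Ft,
    forall z, box z0 rho z -> [/\ jet F Fx Fxx Ft z, `|F z - u z| <= eps &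
      Ft z - (a * Fxx z + b * Fx z - r * F z) = 0].
Proof.
move=> /nbhs_open_domain zO /nbhs_above_psi1 zp.
have [d d0 dO] := nbhs_cbox (filterI zO zp); exists d => // eps eps0.
have dO' : cbox z0 (2 * d) `<=` open_domain k1 T by move=> y /dO[].
have [F [Fx [Fxx [Ft FP]]]] := strong_solution_approx sol.1 solution_continuous
  solution_open_domainE d0 dO' eps0.
by exists F, Fx, Fxx, Ft => z /FP[? ? _ H _]; split => //; apply: H => y /dO[].
Qed.

(** One family for both explicit comparison functions: the upper branch of the obstacle and the two
    terms of the European price. *)
Lemma jet_exp (A B l C : R) z :
  jet (fun z => A + B * expR (l * z.1) * expR (C * z.2))
    (fun z => l * (B * expR (l * z.1) * expR (C * z.2)))
    (fun z => l * (l * (B * expR (l * z.1) * expR (C * z.2))))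
    (fun z => C * (B * expR (l * z.1) * expR (C * z.2))) z.
Proof.
have dexp (A' B' l' x : R) :
    is_derive x 1 (fun s => A' + B' * expR (l' * s)) (l' * (B' * expR (l' * x))).
  have dl : is_derive x 1 (fun s => l' * s) l'.
    rewrite (_ : (fun s => _) = (fun s => 0 + l' * s)); first exact: is_derive_affine.
    by apply/funext => s; rewrite add0r.
  have H1 := is_derive1_comp (is_derive_expR (l' * x)) dl.
  have H := is_deriveD (is_derive_cst A' x 1) (@is_deriveZ _ _ _ _ B' _ _ _ H1).
  by apply: is_derive_eq H _; rewrite add0r /GRing.scale/=; ring.
have eqd (k k' : R -> R) (x v v' : R) : k =1 k' -> v = v' ->
    is_derive x 1 k v -> is_derive x 1 k' v' by move=> /funext -> ->.
split => /=.
- apply: cvgD; first exact: cvg_cst.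
  apply: cvgM; first apply: cvgM; first exact: cvg_cst.
    apply: continuous_comp; last exact: continuous_expR.
    by apply: cvgM; [exact: cvg_cst|exact: cvg_fst].
  apply: continuous_comp; last exact: continuous_expR.
  by apply: cvgM; [exact: cvg_cst|exact: cvg_snd].
- by apply: eqd (dexp A (B * expR (C * z.2)) l z.1) => [s|]; ring.
- by apply: eqd (dexp 0 (l * (B * expR (C * z.2))) l z.1) => [s|]; ring.
- exact: dexp.
Qed.

(** The function [E = exp x - m] lies below [u] and touches it at [z0]. So [E - u] has a local
    maximum [0] there, and as [u] is a supersolution the residual [q * exp x - r * m] of [E] cannot
    be negative. Since the residual must be bounded on a whole square around [z0], this is first
    shown with [z0.1 + d] in place of [z0.1]. *)
Lemma contact_drift z0 : open_domain k1 T z0 -> K1 < expR z0.1 ->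
  u z0 = psi z0.1 -> r * m <= q * expR z0.1.
Proof.
move=> zO zK uz.
pose E z := - m + 1 * expR (1 * z.1) * expR (0 * z.2).
have EE z : E z = expR z.1 - m by rewrite /E mul0r !mul1r expR0; ring.
have key d : 0 < d -> r * m <= q * expR (z0.1 + d).
  move=> d0; have [rho rho0 FP] := super_approx zO.
  have [d1 d10 dO] := nbhs_cbox (nbhs_open_domain zO).
  rewrite -subr_ge0.
  have f0 : E z0 - u z0 = 0 by rewrite EE uz psi1_high ?subrr// ltW.
  rewrite -[leLHS](mulr0 r) -f0.
  apply: (@local_max _ a b r _ (fun z => E z - u z) z0 d1) => //.
  - by rewrite divr_ge0// sqr_ge0.
  - exact: ltW.
  - exists (Num.min rho d); first by rewrite lt_min rho0.
    move=> eps eps0; have [F [Fx [Fxx [Ft FP']]]] := FP eps eps0.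
    pose g z := 1 * expR (1 * z.1) * expR (0 * z.2).
    exists (fun z => E z - F z), (fun z => 1 * g z - Fx z),
      (fun z => 1 * (1 * g z) - Fxx z), (fun z => 0 * g z - Ft z).
    move=> z [z1 z2].
    have zr : box z0 rho z by split; [move: z1|move: z2]; rewrite lt_min => /andP[].
    have zd : expR z.1 <= expR (z0.1 + d).
      move: z1; rewrite lt_min !ltr_distl => /andP[_ /andP[_ z1]].
      by rewrite ler_expR ltW.
    have [jF Fu ineq] := FP' z zr; split.
    + exact: jetB (jet_exp (- m) 1 1 0 z) jF.
    + by rewrite opprB addrC addrA subrK distrC.
    + rewrite EE /g !mul0r expR0 !mul1r mulr1.
      have := ler_wpM2l hq zd; move: ineq; lra.
  - move=> z [z1 z2] _; rewrite f0 subr_le0 EE.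
    apply: le_trans (psi1_ge_exp _) (solution_ge_psi1 _).
    have [] : open_domain k1 T z by apply: dO; split; lra.
    by move=> /ltW zx /andP[/ltW zt0 /ltW ztT]; split => //; rewrite zt0.
(* The limit [d -> 0], made quantitative: [d] is small against the supposed gap [g], and
   [exp d <= 1 + 2 * d] for [d <= 1 / 2]. *)
rewrite leNgt; apply/negP => H.
have S0 : 0 < expR z0.1 by exact: expR_gt0.
pose g := r * m - q * expR z0.1; have g0 : 0 < g by rewrite subr_gt0.
pose w := q * expR z0.1; have w0 : 0 <= w by rewrite mulr_ge0// ltW.
pose d := Num.min (1 / 2) (g / (4 * (w + 1))).
have W : 0 < 4 * (w + 1) by lra.
have d0 : 0 < d by rewrite lt_min !divr_gt0.
have [d1 d2] : d <= 1 / 2 /\ d <= g / (4 * (w + 1)) by rewrite /d !ge_min !lexx orbT.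
have := key d d0; rewrite expRD mulrA -/w.
have := expR_le_quad (ltW d0) d1 => eD.
have eD' : expR d <= 1 + 2 * d by nra.
have := ler_wpM2l w0 eD'.
have : d * (4 * (w + 1)) <= g by rewrite -ler_pdivlMr.
by rewrite /g -/w; nra.
Qed.

(** Where [u] exceeds [K2 - K1] it exceeds the obstacle and solves the equation, whereas a positive
    constant is a supersolution because [r > 0]. For [r < q] this controls the lateral boundary of
    the translated comparison. *)
Lemma solution_le z : z.1 <= ln k1 -> 0 <= z.2 < T -> u z <= K2 - K1.
Proof.
move=> zx /andP[z0 zT]; rewrite -subr_le0.
have [M M0 uM] := solution_bounded.
apply: (@max_principle _ a b r (ln k1) z.2 M (fun z => u z - (K2 - K1))) => //.
- by rewrite divr_ge0// sqr_ge0.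
- by move=> y; apply: cvgB; [exact: solution_continuous|exact: cvg_cst].
- by move=> y _ _; have := uM y; rewrite ler_norml => /andP[_]; move: hK1k1 hk1K2; lra.
- move=> t /andP[t0 tz]; rewrite solution_ln_k1 ?subrr// t0/=.
  by apply: le_trans tz _; exact: ltW.
- by move=> x xk; rewrite solution_init// subr_le0 psi1_le.
- move=> y yx /andP[y0 yz]; rewrite subr_gt0 => uy.
  have yO : open_domain k1 T y by split => //; rewrite y0 (le_lt_trans yz).
  have yp : psi y.1 < u y by apply: le_lt_trans uy; apply: psi1_le; exact: ltW.
  have [rho rho0 FP] := exact_approx yO yp; exists rho => // eps eps0.
  have [F [Fx [Fxx [Ft FP']]]] := FP eps eps0.
  exists (fun z => F z - ((K2 - K1) + 0 * z.1 + 0 * z.2)), (fun z => Fx z - 0),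
    (fun z => Fxx z - 0), (fun z => Ft z - 0) => w /FP'[jF Fu eqF].
  have E : (K2 - K1) + 0 * w.1 + 0 * w.2 = K2 - K1 by rewrite !mul0r !addr0.
  split; first exact: jetB jF (jet_affine _ _ _ _).
  - by rewrite E (_ : _ - _ - _ = F w - u w)//; ring.
  - rewrite E; have : 0 <= r * (K2 - K1).
      by rewrite mulr_ge0 ?(ltW hr)//; move: hK1k1 hk1K2; lra.
    by move: eqF; lra.
- by rewrite lexx z0.
Qed.

Section drift_condition.
Context (hcond : r * m <= q * k1).

(* [expR (x - q t) - m expR (- r t)] solves the equation exactly: it is the price
   of receiving [expR x - m] at expiry. *)
Lemma solution_ge_european h z : 0 < h < T -> z.1 <= ln k1 -> 0 <= z.2 <= h ->
  expR (z.1 - q * z.2) - m * expR (- (r * z.2)) - k1 * (q * h) ^+ 2 <= u z.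
Proof.
move=> /andP[h0 hT'] zx zt; rewrite -subr_le0.
(* At [x = ln k1] the hypothesis [hcond] handles the terms of first order in time; [e] absorbs the
   quadratic term of [exp (- q t)]. *)
set e := k1 * (q * h) ^+ 2.
have e0 : 0 <= e by rewrite mulr_ge0 ?sqr_ge0 ?(ltW k1_gt0).
pose g1 z := 1 * expR (1 * z.1) * expR (- q * z.2).
pose g2 z := m * expR (0 * z.1) * expR (- r * z.2).
pose f z := ((0 + g1 z) - (e + g2 z)) - u z.
have fE y : expR (y.1 - q * y.2) - m * expR (- (r * y.2)) - e - u y = f y.
  by rewrite /f /g1 /g2 mul0r !mul1r expR0 mulr1 expRD !mulNr; ring.
rewrite fE.
have jf y : jet (fun z => (0 + g1 z) - (e + g2 z))
    (fun z => 1 * g1 z - 0 * g2 z) (fun z => 1 * (1 * g1 z) - 0 * (0 * g2 z))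
    (fun z => - q * g1 z - - r * g2 z) y.
  by apply: jetB; exact: jet_exp.
have cg : continuous (fun z => (0 + g1 z) - (e + g2 z)) by move=> y; have [] := jf y.
have [M M0 uM] := solution_bounded.
apply: (@max_principle _ a b r (ln k1) h (k1 + `|m| + M) f) => //.
- by rewrite divr_ge0// sqr_ge0.
- by move=> y; apply: cvgB; [exact: cg|exact: solution_continuous].
- move=> y yx /andP[y0 _]; rewrite -fE.
  have := uM y; rewrite ler_norml => /andP[uMy _].
  have H1 : expR (y.1 - q * y.2) <= k1.
    apply: expR_le_k1; have := mulr_ge0 hq y0; lra.
  have : - (m * expR (- (r * y.2))) <= `|m|.
    apply: le_trans (ler_norm _) _; rewrite normrN normrM (ger0_norm (expR_ge0 _)).
    rewrite ler_piMr// -expR0 ler_expR.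
    by rewrite oppr_le0 mulr_ge0// ltW.
  lra.
- move=> t /andP[t0 th].
  have tT : 0 <= t <= T by rewrite t0 (le_trans th)// ltW.
  rewrite -fE solution_ln_k1//= expRD lnK ?posrE//.
  have qt : 0 <= q * t by rewrite mulr_ge0.
  have rt : 0 <= r * t by rewrite mulr_ge0// ltW.
  have H1 := expRN_le_quad qt.
  have H2 : (q * t) ^+ 2 <= (q * h) ^+ 2.
    by rewrite ler_pXn2r ?nnegrE ?mulr_ge0 ?(ltW h0)// ler_wpM2l.
  have H3 := ler_wpM2l (ltW k1_gt0) H1.
  have H4 := ler_wpM2l (ltW k1_gt0) H2; rewrite -/e in H4.
  have H5 := ler_wpM2l t0 hcond.
  have H6 := expR_ge1Dx (- (r * t)).
  have H7 : k1 * expR (- (q * t)) <= k1.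
    by rewrite ler_piMr ?(ltW k1_gt0)// -expR0 ler_expR oppr_le0.
  have H8 : expR (- (r * t)) <= 1 by rewrite -expR0 ler_expR oppr_le0.
  (* For [m >= 0] the linear lower bound on [exp (- r t)] brings in [hcond]; for [m < 0] both
     exponentials err in the favourable direction. *)
  have [m0|m0] := leP 0 m.
    have H9 := ler_wpM2l m0 H6; lra.
  have H9 : - m * expR (- (r * t)) <= - m by rewrite ler_piMr// oppr_ge0 ltW.
  lra.
- move=> x xk; rewrite -fE solution_init//=.
  have := psi1_ge_exp x.
  by rewrite !mulr0 oppr0 expR0 addr0 mulr1; lra.
- move=> y yx /andP[y0 yh] _.
  have yO : open_domain k1 T y by split => //; rewrite y0 (le_lt_trans yh).
  have [rho rho0 FP] := super_approx yO; exists rho => // eps eps0.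
  have [F [Fx [Fxx [Ft FP']]]] := FP eps eps0.
  eexists; eexists; eexists; eexists => w /FP'[jF Fu ineq].
  split; first exact: jetB (jf w) jF.
  - by rewrite /f (_ : _ - _ - _ = u w - F w); [rewrite distrC|ring].
  - have : 0 <= r * e by rewrite mulr_ge0// ltW.
    by move: ineq => /=; lra.
Qed.

(** With [S = exp x], the right side is the upper branch evaluated along the translate and equals
    [S exp(q h) - m exp(r h)]. Its derivative at [h = 0] is [q S - r m >= 0], so only a quadratic
    loss from [m exp(r h)] remains. *)
Lemma contact_growth (S h : R) : 0 <= S -> r * m <= q * S -> 0 <= h ->
  r * h <= 1 / 2 ->
  S - m - 2 * `|m| * r ^+ 2 * h ^+ 2 <= expR (r * h) * (S * expR (- ((r - q) * h)) - m).
Proof.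
move=> S0 mS h0 rh1.
have rh : 0 <= r * h by rewrite mulr_ge0// ltW.
have qh : 0 <= q * h by rewrite mulr_ge0.
have -> : expR (r * h) * (S * expR (- ((r - q) * h)) - m) =
    S * expR (q * h) - m * expR (r * h).
  rewrite mulrBr mulrCA -expRD; congr (_ * expR _ - _); first by ring.
  by rewrite mulrC.
have H1 := ler_wpM2l S0 (expR_ge1Dx (q * h)).
have H2 := ler_wpM2l h0 mS.
have H3 := expR_le_quad rh rh1.
have [m0|m0] := leP 0 m.
  rewrite ger0_norm//; have := ler_wpM2l m0 H3; rewrite exprMn; lra.
have H4 : S <= S * expR (q * h) by rewrite ler_peMr// -expR0 ler_expR.
have H5 : 1 <= expR (r * h) by rewrite -expR0 ler_expR.
have H6 : - m <= - m * expR (r * h) by rewrite ler_peMr// oppr_ge0 ltW.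
have : 0 <= 2 * `|m| * r ^+ 2 * h ^+ 2 by do 2 (apply: mulr_ge0; last exact: sqr_ge0); exact: mulr_ge0.
by lra.
Qed.

(* This is the discrete form of [u_t - (r - q) u_x + r u >= 0], i.e. of the
   convexity of the price in [expR x] where the equation holds. *)
Lemma solution_time_shift : exists C h0, 0 < h0 /\ forall h z, 0 < h < h0 ->
  z.1 <= ln k1 -> z.1 - (r - q) * h <= ln k1 -> 0 <= z.2 -> z.2 + h < T ->
  u z <= expR (r * h) * u (h *: (- (r - q), 1) + z) + C * h ^+ 2.
Proof.
(* The constant adds the loss of [contact_growth] to twice the error of the European bound, the
   factor [2] bounding [exp (r * h)]. Taking [h] below [1 / (2 r)] gives [r * h <= 1 / 2], as the
   quadratic bound on [exp] requires. *)
exists (2 * `|m| * r ^+ 2 + 2 * k1 * q ^+ 2), (2 * r)^-1.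
split; first by rewrite invr_gt0 mulr_gt0.
move=> h z /andP[h0 hh] zx zx' z0 zT.
have rh1 : r * h <= 1 / 2.
  have : h * (2 * r) < 1 by rewrite -ltr_pdivlMr ?mulr_gt0// div1r.
  by lra.
have rh0 : 0 <= r * h by rewrite mulr_ge0// ltW.
have e2 : expR (r * h) <= 2 by have := expR_le_quad rh0 rh1; nra.
have e1 : 1 <= expR (r * h) by rewrite -expR0 ler_expR.
have e0 := expR_ge0 (r * h).
set c : R * R := h *: (- (r - q), 1).
have c1 y : (c + y).1 = y.1 - (r - q) * h by rewrite /c /= /GRing.scale/= mulrN addrC mulrC.
have c2 y : (c + y).2 = y.2 + h by rewrite /c /= /GRing.scale/= mulr1 addrC.
(* A point and its translate must both lie in the domain; for [r < q] the translate moves to the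
   right and the half-line has to shrink. *)
pose xb := Num.min (ln k1) (ln k1 + (r - q) * h).
have [xb1 xb2] : xb <= ln k1 /\ xb <= ln k1 + (r - q) * h.
  by rewrite /xb !ge_min !lexx orbT.
have cD y : y.1 <= xb -> 0 <= y.2 -> y.2 <= z.2 -> closed_domain k1 T (c + y).
  move=> yx y0 yz; split; first by rewrite c1; lra.
  by rewrite c2; apply/andP; split; lra.
set C := 2 * `|m| * r ^+ 2 + 2 * k1 * q ^+ 2.
have CE : C * h ^+ 2 = 2 * `|m| * r ^+ 2 * h ^+ 2 + 2 * k1 * (q * h) ^+ 2.
  by rewrite /C exprMn; ring.
have A0 : 0 <= 2 * `|m| * r ^+ 2 * h ^+ 2.
  by do 2 (apply: mulr_ge0; last exact: sqr_ge0); exact: mulr_ge0.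
have B0 : 0 <= k1 * (q * h) ^+ 2 by apply: mulr_ge0; [exact: ltW|exact: sqr_ge0].
pose f y := u y - expR (r * h) * u (c + y) - C * h ^+ 2.
have Vcst y : closed_domain k1 T (c + y) -> K2 - k1 <= expR (r * h) * u (c + y).
  move=> yD; have := psi1_ge_cst (c + y).1; have := solution_ge_psi1 yD.
  have : 0 < K2 - k1 by rewrite subr_gt0.
  by move: (u (c + y)) => U ? ? ?; nra.
have Vexp y : closed_domain k1 T (c + y) -> r * m <= q * expR y.1 ->
    expR y.1 - m <= expR (r * h) * u (c + y) + 2 * `|m| * r ^+ 2 * h ^+ 2.
  move=> yD ym; rewrite -lerBlDr.
  apply: le_trans (contact_growth (expR_ge0 _) ym (ltW h0) rh1) _.
  rewrite ler_wpM2l//; apply: le_trans (solution_ge_psi1 yD).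
  by have := psi1_ge_exp (c + y).1; rewrite c1 expRD.
suff : f z <= 0 by rewrite /f; lra.
have [M M0 uM] := solution_bounded.
apply: (@max_principle _ a b r xb z.2 (M + 2 * M) f) => //.
- by rewrite divr_ge0// sqr_ge0.
- move=> y; apply: cvgB; last exact: cvg_cst.
  apply: cvgB; first exact: solution_continuous.
  apply: cvgM; first exact: cvg_cst.
  apply: (@continuous_comp _ _ _ (fun z => c + z) u); last exact: solution_continuous.
  by apply: cvgD; [exact: cvg_cst|exact: cvg_id].
- move=> y _ _; have := uM y; have := uM (c + y); rewrite !ler_norml.
  move=> /andP[h1 _] /andP[_ h2].
  rewrite /f CE; move: h1 h2; move: (u y) (u (c + y)) => U V h1 h2.
  have H1 : expR (r * h) * - V <= expR (r * h) * M by apply: ler_wpM2l => //; lra.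
  have H2 : expR (r * h) * M <= 2 * M by apply: ler_wpM2r.
  by lra.
- move=> t /andP[t0 tz].
  have yD : closed_domain k1 T (c + (xb, t)) by apply: cD.
  have tT : 0 <= t <= T by rewrite t0/=; lra.
  (* If [r >= q], the point itself is on [x = ln k1] and [hcond] is the condition of [Vexp] there.
     If [r < q], its translate is on [x = ln k1], where the solution takes the value [K2 - K1] that
     bounds it by [solution_le]. *)
  rewrite /f CE; have [rq|rq] := leP 0 ((r - q) * h).
    have xbE : xb = ln k1 by rewrite /xb; apply/min_idPl; rewrite lerDl.
    have := Vexp _ yD; rewrite xbE /= lnK ?posrE// => /(_ hcond).
    by rewrite -/(u _) -[Y _]/(u (ln k1, t)) solution_ln_k1//; lra.
  have xbE : xb = ln k1 + (r - q) * h.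
    by rewrite /xb; apply/min_idPr; rewrite gerDl ltW.
  have cE : c + (xb, t) = (ln k1, t + h).
    by rewrite [LHS]surjective_pairing c1 c2 xbE /= addrK.
  have tT' : 0 <= (xb, t).2 < T by apply/andP; split => /=; lra.
  have H1 := @solution_le (xb, t) xb1 tT'.
  rewrite cE solution_ln_k1; last by apply/andP; split; lra.
  have : K2 - K1 <= expR (r * h) * (K2 - K1) by rewrite ler_peMl//; move: hK1k1 hk1K2; lra.
  by lra.
- move=> x xxb.
  have yD : closed_domain k1 T (c + (x, 0)) by apply: cD.
  rewrite /f CE solution_init; last exact: le_trans xb1.
  have [xK|xK] := leP (expR x) K1.
    by rewrite psi1_low//; have := Vcst _ yD; lra.
  rewrite psi1_high ?(ltW xK)//.
  (* The factor [exp (r h)] and the translation undo the discounting of the European price at time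
     [h]: what is left is [exp x - m], up to the error term. *)
  have hT' : 0 < h < T by rewrite h0; lra.
  have [yD1 _] := yD.
  have := @solution_ge_european h (c + (x, 0)) hT' yD1.
  rewrite c2 c1/= add0r lexx (ltW h0) => /(_ isT) H.
  have := ler_wpM2l e0 H; rewrite !mulrBr mulrCA -!expRD.
  rewrite (_ : r * h + (x - (r - q) * h - q * h) = x); last by ring.
  rewrite subrr expR0 mulr1.
  have : expR (r * h) * (k1 * (q * h) ^+ 2) <= 2 * (k1 * (q * h) ^+ 2).
    by rewrite ler_wpM2r.
  by rewrite -[Y _]/(u (c + (x, 0))); lra.
- move=> y yx /andP[y0 yz] fy.
  have yO : open_domain k1 T y.
    by split; [exact: lt_le_trans yx xb1|apply/andP; split; lra].
  have yD := cD y (ltW yx) (ltW y0) yz.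
  have cO : open_domain k1 T (c + y).
    by split; [rewrite c1; lra|rewrite c2; apply/andP; split; lra].
  (* A point with [f y > 0] is not a contact point: [Vcst] excludes the lower branch, and on the
     upper one [contact_drift] supplies the condition of [Vexp]. *)
  have yp : psi y.1 < u y.
    have [yO1 /andP[yO2 yO3]] := yO.
    have yCD : closed_domain k1 T y by split; [exact: ltW|rewrite !ltW].
    rewrite lt_neqAle solution_ge_psi1// andbT; apply/eqP => E.
    move: fy; rewrite /f CE -E; have [yK|yK] := leP (expR y.1) K1.
      by rewrite psi1_low//; have := Vcst _ yD; lra.
    have := Vexp _ yD (contact_drift yO yK (esym E)).
    by rewrite psi1_high ?(ltW yK)//; lra.
  have [rho1 rho10 FP] := exact_approx yO yp.
  have [rho2 rho20 GP] := super_approx cO.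
  exists (Num.min rho1 rho2); first by rewrite lt_min rho10.
  move=> eps eps0.
  have eps40 : 0 < eps / 4 by rewrite divr_gt0.
  have [F [Fx [Fxx [Ft FP']]]] := FP _ eps40.
  have [G [Gx [Gxx [Gt GP']]]] := GP _ eps40.
  eexists; eexists; eexists; eexists => w [w1 w2].
  have wF : box y rho1 w by split; [move: w1|move: w2]; rewrite lt_min => /andP[].
  have wG : box (c + y) rho2 (c + w).
    have E1 : (c + w).1 - (c + y).1 = w.1 - y.1 by rewrite /=; ring.
    have E2 : (c + w).2 - (c + y).2 = w.2 - y.2 by rewrite /=; ring.
    by split; rewrite ?E1 ?E2; [move: w1|move: w2]; rewrite lt_min => /andP[].
  have [jF Fu Feq] := FP' w wF; have [jG Gu Gle] := GP' _ wG.
  split.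
  + exact: jetB (jetB jF (jetZ (expR (r * h)) (jet_shift jG))) (jet_affine (C * h ^+ 2) 0 0 w).
  + rewrite /f !mul0r !addr0.
    have -> : F w - expR (r * h) * G (c + w) - C * h ^+ 2 -
      (u w - expR (r * h) * u (c + w) - C * h ^+ 2) =
      (F w - u w) - expR (r * h) * (G (c + w) - u (c + w)) by ring.
    apply: le_trans (ler_normB _ _) _; rewrite normrM (ger0_norm e0).
    have : expR (r * h) * `|G (c + w) - u (c + w)| <= 2 * (eps / 4) by apply: ler_pM.
    by lra.
  + have : 0 <= r * (C * h ^+ 2) by rewrite CE mulr_ge0 ?(ltW hr)//; lra.
    by have := mulr_ge0 e0 Gle; move: Feq; rewrite /= !mul0r !addr0; lra.
- by rewrite /xb le_min zx/=; lra.
- by rewrite z0 lexx.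
Qed.

End drift_condition.

End one_solution.

(** * Comparison of two volatilities *)

Lemma solution_mono_volatility_open (s s' : R) (Y Y' : R * R -> R) :
  bounded_strong_solution K1 k1 K2 r q T s p Y ->
  bounded_strong_solution K1 k1 K2 r q T s' p Y' ->
  0 < s -> s <= s' -> r * m <= q * k1 -> forall z, z.1 <= ln k1 ->
  0 <= z.2 < T -> (Y \o clamp k1 T) z <= (Y' \o clamp k1 T) z.
Proof.
move=> sol sol' s0 ss' hcond z zx /andP[z0 zT].
set u := Y \o clamp k1 T; set v := Y' \o clamp k1 T.
have cu : continuous u := solution_continuous sol.
have cv : continuous v := solution_continuous sol'.
have [M M0 uM] := solution_bounded sol.
have [N N0 vN] := solution_bounded sol'.
have [C [h0 [h00 shift_le]]] := solution_time_shift sol hcond.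
rewrite -subr_le0.
apply: (@max_principle _ (s' ^+ 2 / 2) (r - q - s' ^+ 2 / 2) r (ln k1) z.2 (M + N)
  (fun z => u z - v z)) => //.
- by rewrite divr_ge0// sqr_ge0.
- by move=> y; apply: cvgB; [exact: cu|exact: cv].
- move=> y _ _; have := uM y; have := vN y; rewrite !ler_norml -/u -/v.
  by move=> /andP[? _] /andP[_ ?]; lra.
- move=> t /andP[t0 tz].
  have tT : 0 <= t <= T by rewrite t0/=; lra.
  by rewrite /u /v (solution_ln_k1 sol)// (solution_ln_k1 sol')// subrr.
- by move=> x xk; rewrite /u /v (solution_init sol)// (solution_init sol')// subrr.
- move=> y yx /andP[y0 yz]; rewrite subr_gt0 => vu.
  have yT : y.2 < T by exact: le_lt_trans yz zT.
  have yO : open_domain k1 T y by split => //; rewrite y0.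
  (* Where [u] exceeds [v] it exceeds the obstacle, since [v] lies above it; so the equation for [u]
     is available. *)
  have yp : psi y.1 < u y.
    apply: le_lt_trans vu; apply: (solution_ge_psi1 sol').
    by split; [exact: ltW|rewrite !ltW].
  (* A margin inside the domain: near [y], translates by [h < de / n] meet the conditions of
     [shift_le] on [x] and on time. *)
  pose de := Num.min (ln k1 - y.1) (T - y.2) / 2.
  have de0 : 0 < de by rewrite divr_gt0// lt_min !subr_gt0 yx.
  have [de1 de2] : 2 * de <= ln k1 - y.1 /\ 2 * de <= T - y.2.
    by rewrite /de mulrC divfK// !ge_min !lexx orbT.
  have nde : nbhs y [set w : R * R | w.1 + de < ln k1 /\ w.2 + de < T].
    apply/nbhs_boxP; exists de => // w [].
    by rewrite !ltr_distl => /andP[_ w1] /andP[_ w2]; split; lra.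
  have [d d0 dP] := nbhs_cbox (filterI (filterI (nbhs_open_domain yO)
    (nbhs_above_psi1 sol yp)) nde).
  have dO : cbox y (2 * d) `<=` open_domain k1 T by move=> w /dP[[]].
  have [rho rho0 GP] := super_approx sol' yO.
  exists (Num.min d rho); first by rewrite lt_min d0.
  move=> eps eps0.
  have eps20 : 0 < eps / 2 by lra.
  have [F [Fx [Fxx [Ft FP]]]] := strong_solution_approx sol.1 cu
    (solution_open_domainE Y) d0 dO eps20.
  have [G [Gx [Gxx [Gt GP']]]] := GP _ eps20.
  exists (fun z => F z - G z), (fun z => Fx z - Gx z), (fun z => Fxx z - Gxx z),
    (fun z => Ft z - Gt z) => w [w1 w2].
  have wF : box y d w by split; [move: w1|move: w2]; rewrite lt_min => /andP[].
  have wG : box y rho w by split; [move: w1|move: w2]; rewrite lt_min => /andP[].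
  have [jF Fu _ Feq Fsh] := FP w wF; have [jG Gv Gle] := GP' w wG.
  split; first exact: jetB.
  + have -> : F w - G w - (u w - v w) = (F w - u w) - (G w - v w) by ring.
    by apply: le_trans (ler_normB _ _) _; rewrite -/v in Gv; lra.
  + have {}Feq : Ft w - opL r q s (F w) (Fx w) (Fxx w) = 0.
      by apply: Feq => x /dP[[]].
    pose n := `|r - q| + 1; have n0 : 0 < n by rewrite ltr_wpDl.
    have h1_gt0 : 0 < Num.min h0 (de / n) by rewrite lt_min h00 divr_gt0.
    have {}Fsh : 0 <= Ft w - (r - q) * Fx w + r * F w.
      apply: (Fsh C _ h1_gt0) => h x /andP[h_gt0]; rewrite lt_min => /andP[hh0 hde].
      move=> /dP[[[xk /andP[x0 xT]] _] [x1 x2]].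
      have hn : h * n < de by rewrite -ltr_pdivlMr.
      have hrq : - ((r - q) * h) <= h * `|r - q|.
        rewrite mulrC -mulrN ler_wpM2l ?(ltW h_gt0)//.
        by rewrite -normrN ler_norm.
      have hhn : h * n = h * `|r - q| + h by rewrite /n; ring.
      have hq0 : 0 <= h * `|r - q| by rewrite mulr_ge0// ltW.
      apply: shift_le; [by rewrite h_gt0|exact: ltW| |exact: ltW|].
        by lra.
      by lra.
    have a0 : 0 < s ^+ 2 / 2 by rewrite divr_gt0// exprn_gt0.
    have aa' : s ^+ 2 / 2 <= s' ^+ 2 / 2.
      by rewrite ler_pM2r ?invr_gt0// ler_pXn2r// nnegrE ?(ltW s0)// (le_trans (ltW s0)).
    rewrite /opL in Feq.
    (* By the equation, [s ^+ 2 / 2 * (Fxx - Fx)] equals the first-order expression in [Fsh]. The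
       sign of [Fxx - Fx] is what makes [F] a subsolution for [s']. *)
    have D : 0 <= Fxx w - Fx w.
      by rewrite -(pmulr_rge0 _ a0); lra.
    have := mulr_ge0 (_ : 0 <= s' ^+ 2 / 2 - s ^+ 2 / 2) D.
    by rewrite subr_ge0 => /(_ aa'); lra.
- by rewrite z0 lexx.
Qed.

Lemma solution_mono_volatility (s s' : R) (Y Y' : R * R -> R) :
  bounded_strong_solution K1 k1 K2 r q T s p Y ->
  bounded_strong_solution K1 k1 K2 r q T s' p Y' ->
  0 < s -> s <= s' -> r * m <= q * k1 ->
  forall z, closed_domain k1 T z -> Y z <= Y' z.
Proof.
move=> sol sol' s0 ss' hcond z zD; have [zx /andP[z0 zT]] := zD.
rewrite -(solution_clampE Y zD) -(solution_clampE Y' zD).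
have [{}zT|Tz] := ltP z.2 T.
  apply: (solution_mono_volatility_open sol sol' s0 ss' hcond zx).
  by rewrite z0 zT.
(* At the final time, a strict reverse inequality would persist at slightly earlier times by
   continuity. *)
rewrite leNgt; apply/negP => H.
have cf : continuous (fun z => (Y \o clamp k1 T) z - (Y' \o clamp k1 T) z).
  by move=> y; apply: cvgB; [exact: (solution_continuous sol)|exact: (solution_continuous sol')].
have /cvgr_gt/(_ 0) := cf z; rewrite subr_gt0 => /(_ H) /nbhs_boxP[d d0 dP].
pose t := Num.max 0 (T - d / 2).
have [t1 t2] : 0 <= t /\ T - d / 2 <= t by rewrite /t !le_max !lexx orbT.
have tT : t < T by rewrite /t gt_max hT/=; lra.
have zTE : z.2 = T by apply/eqP; rewrite eq_le zT Tz.
have : box z d (z.1, t).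
  split => /=; first by rewrite subrr normr0.
  by rewrite zTE ltr_norml; apply/andP; split; lra.
move=> /dP /=; rewrite subr_gt0 ltNge => /negP; apply.
by apply: (solution_mono_volatility_open sol sol' s0 ss' hcond) => //; rewrite t1 tT.
Qed.

End obstacle_problem.

(** * From ordered solutions to ordered free boundaries *)

Theorem theorem4p13 (R : realType) (K1 k1 k2 K2 r q T p : R)
    (hK1 : 0 < K1) (hK1k1 : K1 < k1) (hk1k2 : k1 < k2) (hk2K2 : k2 < K2)
    (hr : 0 < r) (hq : 0 <= q) (hT : 0 < T) (hp : 1 < p)
    (hcond : r * (K1 + k1 - K2) <= q * k1)
    (Y : R -> R * R -> R) (A B : R -> R -> R)
    (hY : forall sigma : R, 0 < sigma ->
      bounded_strong_solution K1 k1 K2 r q T sigma p (Y sigma))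
    (hA : forall sigma tau : R, 0 < sigma -> 0 < tau <= T ->
      is_max (lower_contact K1 k1 K2 (Y sigma) tau) (A sigma tau))
    (hB : forall sigma tau : R, 0 < sigma -> 0 < tau <= T ->
      is_min (upper_contact K1 k1 K2 (Y sigma) tau) (B sigma tau)) :
  forall tau : R, 0 < tau <= T ->
    (forall sigma sigma' : R, 0 < sigma -> sigma <= sigma' ->
       A sigma' tau <= A sigma tau) /\
    (forall sigma sigma' : R, 0 < sigma -> sigma <= sigma' ->
       B sigma tau <= B sigma' tau).
Proof.
move=> tau tauT; have /andP[tau0 tauT'] := tauT.
have hk1K2 := lt_trans hk1k2 hk2K2.
have k10 := lt_trans hK1 hK1k1.
have lnK : ln K1 <= ln k1 by rewrite ler_ln ?posrE// ltW.
have D x : x <= ln k1 -> closed_domain k1 T (x, tau).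
  by move=> xk; split => //=; rewrite ltW.
have mono s s' x : 0 < s -> s <= s' -> x <= ln k1 -> Y s (x, tau) <= Y s' (x, tau).
  move=> s0 ss' xk.
  exact: (solution_mono_volatility hK1 hK1k1 hk1K2 hr hq hT (hY s s0)
    (hY s' (lt_le_trans s0 ss')) s0 ss' hcond (D x xk)).
have psiY s x : 0 < s -> x <= ln k1 -> psi1 K1 k1 K2 x <= Y s (x, tau).
  move=> s0 xk; rewrite -(solution_clampE (Y s) (D x xk)).
  exact: (solution_ge_psi1 hK1 hK1k1 hT (hY s s0) (D x xk)).
split=> s s' s0 ss'; have s'0 := lt_le_trans s0 ss'.
(* A contact point for [s'] is one for [s], because [Y s] lies between the obstacle and [Y s']. The
   contact sets thus shrink as the volatility grows, and the extremality of [A s tau] concludes. *)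
- have [[xK Ex] _] := hA s' tau s'0 tauT; have [_ ub] := hA s tau s0 tauT.
  have xk := le_trans xK lnK.
  apply: ub; split => //; apply/eqP; rewrite eq_le -{1}Ex mono//=.
  exact: le_trans (psi1_ge_cst _ _ _ _) (psiY s _ s0 xk).
- have [[/andP[xK xk] Ex] _] := hB s' tau s'0 tauT; have [_ lb] := hB s tau s0 tauT.
  apply: lb; split; first by rewrite xK.
  apply/eqP; rewrite eq_le -{1}Ex mono//=.
  apply: le_trans (psiY s _ s0 xk).
  by apply: le_trans (psi1_ge_exp _ _ _ _); lra.
Qed.
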